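(* For $\alpha\in(0,1]$ and $\theta>0$, define $h_\theta(x)=x^{\frac{1+3\alpha}{2}}\log^{-\theta}\left(\frac1x\right)$. If $\theta>\frac{1+3\alpha}{2}$, then there exists a Furstenberg set $E\subseteq\mathbb{R}^2$ of type $\alpha$ (that is, $E\in F_\alpha$) with $\mathcal{H}^{h_\theta}(E)=0$.
   Context: For $\alpha\in(0,1]$, a set $E\subseteq\mathbb{R}^2$ is a Furstenberg set of type $\alpha$ (written $E\in F_\alpha$) if for each direction $e$ in the unit circle there is a line segment $\ell_e$ in the direction of $e$ such that the Hausdorff dimension of $E\cap\ell_e$ is greater than or equal to $\alpha$. A dimension function is a non-decreasing, right continuous function $h:[0,\infty)\to[0,\infty)$ with $h(0)=0$. The function $h_\theta$ is given by its formula for small $x>0$ (here $\log^{-\theta}(1/x)=(\log(1/x))^{-\theta}$), with $h_\theta(0)=0$, and extended in any way to a dimension function on $[0,\infty)$; only the behaviour near $0$ matters. For a dimension function $h$, a set $E\subseteq\mathbb{R}^n$ and $\delta>0$, put $$\mathcal{H}^h_\delta(E)=\inf\Big\{\sum_i h(\operatorname{diam}(E_i)) : E\subset\bigcup_i E_i,\ \operatorname{diam}(E_i)<\delta\Big\},$$ where the infimum is over countable covers, and $\mathcal{H}^h(E)=\sup_{\delta>0}\mathcal{H}^h_\delta(E)$. *)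

(* Defs.v *)
From HB Require Import structures.
From mathcomp Require Import all_boot all_order all_algebra.
From mathcomp Require Import all_classical all_reals all_analysis.

Set Implicit Arguments.
Unset Strict Implicit.
Unset Printing Implicit Defensive.

Import Order.TTheory GRing.Theory Num.Theory.
Import numFieldNormedType.Exports.

Local Open Scope classical_set_scope.
Local Open Scope ring_scope.

(* The library norm on ['rV[R]_n] is the sup norm. *)
Definition euclidean_norm (R : realType) (n : nat) (v : 'rV[R]_n) : R :=
  Num.sqrt (\sum_(i < n) v ord0 i ^+ 2).

(* The supremum includes 0, so that the empty set has diameter 0 rather than
   -oo. *)
Definition diam (R : realType) (n : nat) (A : set 'rV[R]_n) : \bar R :=
  ereal_sup (0%E |` [set (euclidean_norm (p.1 - p.2))%:E | p in A `*` A]).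

(* A function [0, oo) -> [0, oo) is represented by its values on the
   nonnegative reals; the values at negative reals are unconstrained and never
   used. *)
Definition dimension_function (R : realType) (h : R -> R) : Prop :=
  [/\ forall x, 0 <= x -> 0 <= h x,
      forall x y, 0 <= x -> x <= y -> h x <= h y,
      forall x, 0 <= x -> h y @[y --> x^'+] --> h x
    & h 0 = 0].

(* Covers are indexed by [nat]: finite covers are padded with the empty set,
   which costs [h 0 = 0].  [fine] is harmless as the diameters are below
   [delta]. *)
Definition hausdorff_content (R : realType) (n : nat) (h : R -> R) (delta : R)
    (E : set 'rV[R]_n) : \bar R :=
  ereal_inf [set (\sum_(0 <= i <oo) (h (fine (diam (F i))))%:E)%E
            | F in [set F : nat -> set 'rV[R]_n |
                     E `<=` \bigcup_i F i /\
                     forall i, (diam (F i) < delta%:E)%E]].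

Definition hausdorff_measure (R : realType) (n : nat) (h : R -> R)
    (E : set 'rV[R]_n) : \bar R :=
  ereal_sup [set hausdorff_content h delta E | delta in [set d : R | 0 < d]].

(* Only s > 0 is used, so that x ^ s vanishes at 0; allowing s = 0 (counting
   measure) would not change the infimum. *)
Definition hausdorff_dim (R : realType) (n : nat) (E : set 'rV[R]_n) : \bar R :=
  ereal_inf [set s%:E | s in
    [set s : R | 0 < s /\ hausdorff_measure (fun x : R => x `^ s) E = 0%E]].

Definition segment (R : realType) (n : nat) (p e : 'rV[R]_n) (l : R) :
    set 'rV[R]_n :=
  [set p + t *: e | t in `[0, l]].

Definition furstenberg (R : realType) (alpha : R) (E : set 'rV[R]_2) : Prop :=
  forall e : 'rV[R]_2, euclidean_norm e = 1 ->
    exists (p : 'rV[R]_2) (l : R),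
      0 < l /\ (alpha%:E <= hausdorff_dim (E `&` segment p e l))%E.

(* Meaningful for 0 < x < 1 only. *)
Definition htheta_formula (R : realType) (alpha theta x : R) : R :=
  x `^ ((1 + 3 * alpha) / 2) * ln (x^-1) `^ (- theta).

(* [h] is an extension to a dimension function of the germ at 0+ given by the
   formula. *)
Definition is_htheta (R : realType) (alpha theta : R) (h : R -> R) : Prop :=
  dimension_function h /\
  \forall x \near 0^'+, h x = htheta_formula alpha theta x.

(* Main.v *)
Require Import Defs.
From mathcomp Require Import all_boot all_order all_algebra.
From mathcomp Require Import all_classical all_reals all_analysis.
From mathcomp Require Import ring lra zify.
Import Order.TTheory GRing.Theory Num.Theory.
Import numFieldNormedType.Exports.
Local Open Scope classical_set_scope.
Local Open Scope ring_scope.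

(** The set is built from lines that are extremal for the incidence theorem of
Szemeredi and Trotter, seen in a projective chart, at a rapidly increasing
sequence of scales.

One scale.  Fix a large integer m, put delta = m^-2, and consider the lines
Y = A X + B whose coefficients A = j/m and B = i/m are multiples of 1/m.  Over
the abscissae X = p/q with q at most n = m^alpha, about n^2 in number, such a
line only takes the values (j p + i q) / (m q), so all these lines together
leave about m n over each X, and about m n^3 = m^(1 + 3 alpha) points in all.
Moving X, A and B by O(delta) moves the points by O(delta), so a set of lines
restricted to a neighbourhood of the fractions is covered by
delta^(-(1 + 3 alpha)/2) balls of diameter O(delta).  For the gauge h this cover
costs a constant times the logarithmic factor of h, and tends to 0 as m grows.

All directions.  The slope A only has about m values.  The projective map
(X, Y) -> (1 / (X + sqrt 2), Y / (X + sqrt 2)) sends the line Y = A X + B to the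
line y = a x + A of slope a = B - A sqrt 2.  The combinations i/m - (j/m) sqrt 2
reach every real number of a bounded interval up to O(delta), because the
multiples of sqrt 2 are well distributed modulo 1; this is
[inhomogeneous_sqrt2], which rests on the solutions of the Pell equation.  Slopes
of absolute value at most 1 suffice once the two coordinates may be exchanged.

All scales.  The scales are chosen one after the other ([scale_system_exists]):
each one is so large that every constant depending on the earlier ones is
absorbed by the logarithmic factor of h.  For each slope, [line_parameters]
finds one line which is good at all scales, by nested intervals.  The
covers at the successive scales show that the h-measure vanishes
([furstenberg_set_null]).

Dimension of the sections.  On each line the points X close to a fraction of
denominator O(n) at every scale contain a Cantor set.  At each step a cell
keeps about n^2 subcells of size O(m^-2), one for each member of a family of
fractions with denominators at most 2n, which are separated by 1/(4 n^2).  Such a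
Cantor set is the image of [0, 1[ under a map X with |u - v| <= K |X u - X v|^s for
every s < alpha ([rational_cantor_set]).  A cover of the section by sets E_i
therefore yields a cover of [0, 1[ by sets of diameter at most a multiple of
(diam E_i)^s, and the subadditivity of Lebesgue measure bounds the s-dimensional
measure of the section away from 0 ([hausdorff_measure_powR_neq0]). *)

(** * Nested intervals and inhomogeneous approximation by multiples of sqrt 2 *)

Lemma nested_intervals (R : realType) (L e : nat -> R) :
  (forall k, 0 <= e k) -> (forall k, L k <= L k.+1) ->
  (forall k, L k.+1 + e k.+1 <= L k + e k) ->
  exists x, forall k, L k <= x <= L k + e k.
Proof.
move=> e0 Lup Udown.
have LL i j : (i <= j)%N -> L i <= L j.
  elim: j => [|j IH]; first by rewrite leqn0 => /eqP->.
  by rewrite leq_eqVlt => /orP[/eqP->//|/IH/le_trans]; exact.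
have UU i j : (i <= j)%N -> L j + e j <= L i + e i.
  elim: j => [|j IH]; [by rewrite leqn0 => /eqP-> |rewrite leq_eqVlt => /orP[/eqP->//|/IH]].
  exact: le_trans.
have ub k : ubound (range L) (L k + e k).
  move=> _ [j _ <-]; have [jk|/ltnW kj] := leqP j k.
    by rewrite (le_trans (LL _ _ jk))// lerDl.
  by rewrite (le_trans _ (UU _ _ kj))// lerDl.
have hs : has_sup (range L) by split; [exists (L 0%N); exists 0%N | exists (L 0%N + e 0%N); exact: ub].
exists (sup (range L)) => k; apply/andP; split.
  by apply: sup_upper_bound => //; exists k.
by apply: ge_sup; [exact: hs.1 | exact: ub].
Qed.

(** Multiplication by 3 + 2 sqrt 2, in coordinates, produces larger and larger
solutions. *)
Lemma pell_unbounded (B : nat) :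
  exists p q : nat, (p ^ 2 = 2 * q ^ 2 + 1 /\ B <= q)%N.
Proof.
elim: B => [|B [p [q [pq Bq]]]]; first by exists 1%N, 0%N.
exists (3 * p + 4 * q)%N, (2 * p + 3 * q)%N; rewrite !expnS !expn0 in pq *; split; nia.
Qed.

(** Here (p/q)^2 - 2 = 1/q^2, and p/q + sqrt 2 is at least 1. *)
Lemma pell_sqrt2 (R : realType) (p q : nat) : (0 < q)%N ->
  (p ^ 2 = 2 * q ^ 2 + 1)%N ->
  `|Num.sqrt 2 - p%:R / q%:R| <= (q%:R ^+ 2)^-1 :> R.
Proof.
move=> q0 pq.
have pqR : p%:R ^+ 2 = 2 * q%:R ^+ 2 + 1 :> R by rewrite -!natrX pq natrD natrM.
set t : R := Num.sqrt 2.
have tt : t ^+ 2 = 2 by rewrite sqr_sqrtr.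
have t1 : 1 <= t by rewrite -(sqrtr1 R) ler_sqrt// ler1n.
have qR : 1 <= q%:R :> R by rewrite ler1n.
have q20 : 0 < q%:R ^+ 2 :> R by rewrite exprn_gt0// (lt_le_trans ltr01).
set z : R := p%:R / q%:R.
have z0 : 0 <= z by rewrite divr_ge0.
have zz : z ^+ 2 = 2 + (q%:R ^+ 2)^-1.
  by rewrite /z expr_div_n pqR mulrDl mul1r mulfK// gt_eqF.
have i0 : 0 < (q%:R ^+ 2)^-1 :> R by rewrite invr_gt0.
rewrite ler_norml; apply/andP; split; nra.
Qed.

(** Replace sqrt 2 by its convergent p/q, at a cost of 1/q since r < q, and beta by
the multiple of 1/q below it.  As p is prime to q, some r < q makes
r p + floor(q beta) divisible by q. *)
Lemma inhomogeneous_sqrt2 (R : realType) (p q : nat) (beta : R) : (0 < q)%N ->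
  (p ^ 2 = 2 * q ^ 2 + 1)%N -> 0 <= beta ->
  exists r i : nat, (r < q)%N /\
    `|beta + r%:R * Num.sqrt 2 - i%:R| <= 2 / q%:R.
Proof.
move=> q0 pq b0.
have cpq : coprime q p.
  rewrite /coprime -dvdn1.
  have : (gcdn q p ^ 2 %| 2 * q ^ 2 + 1)%N by rewrite -pq dvdn_exp2r// dvdn_gcdr.
  rewrite dvdn_addr; last by rewrite dvdn_mull// dvdn_exp2r// dvdn_gcdl.
  by apply: dvdn_trans; rewrite expnS dvdn_mulr.
have qR : 0 < q%:R :> R by rewrite ltr0n.
set i0 := Num.truncn (q%:R * beta).
have /andP[i01 i02] : i0%:R <= q%:R * beta < i0.+1%:R.
  by apply: truncn_itv; rewrite mulr_ge0// ltW.
have [r [rq /dvdnP[i ri]]] : exists r, (r < q)%N /\ (q %| r * p + i0)%N.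
  have [u v uv _] := egcdnP p q0.
  (* Bezout: u q = v p + 1, so r = i0 v mod q works. *)
  move: uv; rewrite (eqP cpq) => uv.
  exists ((i0 * v) %% q)%N; split; first by rewrite ltn_pmod.
  rewrite /dvdn -modnDml modnMml modnDml.
  by rewrite -mulnA -[X in (_ + X)%N]muln1 -mulnDr -uv mulnA modnMl.
exists r, i; split => //.
have riR : r%:R * p%:R + i0%:R = i%:R * q%:R :> R by rewrite -!natrM -natrD ri.
have := @pell_sqrt2 R p q q0 pq.
set t : R := Num.sqrt 2.
have -> : i%:R = (r%:R * p%:R + i0%:R) / q%:R :> R.
  by rewrite riR mulfK// gt_eqF.
have -> : beta + r%:R * t - (r%:R * p%:R + i0%:R) / q%:R
    = (q%:R * beta - i0%:R) / q%:R + r%:R * (t - p%:R / q%:R).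
  by field; rewrite gt_eqF.
move=> tpq.
have -> : 2 / q%:R = q%:R^-1 + q%:R^-1 :> R by rewrite mulrDl !mul1r.
rewrite (le_trans (ler_normD _ _))// lerD//.
  rewrite normrM [X in _ * X]gtr0_norm ?invr_gt0//; apply: ler_piMl; first by rewrite invr_ge0 ltW.
  rewrite -[i0.+1]addn1 natrD in i02.
  by rewrite ler_norml; apply/andP; split; lra.
rewrite normrM normr_nat (le_trans (ler_wpM2l _ tpq))//.
rewrite expr2 invfM mulrA; apply: ler_piMl; first by rewrite invr_ge0 ltW.
by rewrite ler_pdivrMr// mul1r ler_nat ltnW.
Qed.

(** * Fractions with bounded denominators *)

Lemma card_multiples (n d : nat) : (0 < d)%N ->
  #|[set x : 'I_n | (d %| x.+1)%N]%SET| = (n %/ d)%N.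
Proof.
move=> d0; rewrite divn_count_dvd big_add1 /= big_mkord -sum1_card big_mkcond /=.
by apply: eq_bigr => i _; rewrite inE; case: (_ %| _)%N.
Qed.

(** Comparison with the telescoping bound 1/d^2 <= 1/(d - 1) - 1/d for d >= 3; the
term 1/4 for d = 2 is kept exact so that the total stays below 3/4. *)
Lemma sum_floor_squares (n K : nat) : (1 < K)%N ->
  \sum_(2 <= d < K.+1) ((n %/ d) ^ 2)%:R <= n%:R ^+ 2 * (3 / 4 - K%:R^-1) :> rat.
Proof.
have le d : (0 < d)%N -> ((n %/ d) ^ 2)%:R <= n%:R ^+ 2 / d%:R ^+ 2 :> rat.
  move=> d0; rewrite natrX -expr_div_n lerXn2r// ?nnegrE ?divr_ge0//.
  by rewrite ler_pdivlMr ?ltr0n// -natrM ler_nat leq_divM.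
elim: K => // K IH; rewrite ltnS leq_eqVlt => /orP[/eqP<-|K1].
  rewrite big_nat1 (le_trans (le 2%N isT))// ler_wpM2l// ?exprn_ge0//; lra.
rewrite big_nat_recr/=; last exact: ltnW.
rewrite (le_trans (lerD (IH K1) (le K.+1 isT)))//.
rewrite -mulrDr; apply: ler_wpM2l; first exact: exprn_ge0.
have K0 : 0 < K%:R :> rat by rewrite ltr0n; lia.
rewrite -[K.+1%:R]natr1; set x : rat := K%:R in K0 *.
have -> : 3 / 4 - (x + 1)^-1 = 3 / 4 - x^-1 + ((x * (x + 1))^-1).
  by field; apply/andP; split; apply: lt0r_neq0; lra.
rewrite lerD2l lef_pV2 ?posrE ?exprn_gt0 ?mulr_gt0 ?addr_gt0//.
by rewrite expr2 ler_wpM2r ?addr_ge0 ?ltW// ltrDl.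
Qed.

(** The pairs divisible by d number floor(n/d)^2, so by the union bound at most
3/4 of all the pairs have a common divisor d >= 2. *)
Lemma card_coprime_pairs (n : nat) :
  (n ^ 2 <= 4 * #|[set xy : 'I_n * 'I_n | coprime xy.1.+1 xy.2.+1]%SET|)%N.
Proof.
have [n1|n1] := leqP n 1.
  case: n n1 => [//|[_|//]]; rewrite (cardsD1 (ord0, ord0)) inE /=.
  by rewrite mulnDr.
set C := [set xy : 'I_n * 'I_n | _]%SET.
pose B d := finset.setX [set x : 'I_n | (d %| x.+1)%N]%SET [set x : 'I_n | (d %| x.+1)%N]%SET.
have cov : [set: 'I_n * 'I_n]%SET \subset (C :|: \bigcup_(d < n.-1) B d.+2)%SET.
  apply/fintype.subsetP => -[x y] _; rewrite inE; apply/orP.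
  have [|ncop] := boolP (coprime x.+1 y.+1); [by left; rewrite inE | right].
  set g := gcdn x.+1 y.+1.
  have g1 : (1 < g)%N by rewrite ltn_neqAle eq_sym ncop gcdn_gt0.
  have gn : (g.-2 < n.-1)%N.
    have : (g <= n)%N by rewrite (leq_trans (dvdn_leq _ (dvdn_gcdl _ _))).
    lia.
  apply/finset.bigcupP; exists (Ordinal gn) => //=.
  by rewrite inE /= !inE /= (_ : g.-2.+2 = g) ?dvdn_gcdl ?dvdn_gcdr//; lia.
have := subset_leq_card cov.
rewrite cardsT card_prod card_ord => /leq_trans/(_ (leq_card_setU _ _)).
have : (#|(\bigcup_(d < n.-1) B d.+2)%SET| <= \sum_(2 <= d < n.+1) (n %/ d) ^ 2)%N.
  rewrite (@big_addn _ _ _ 0%N n.+1 2) (_ : n.+1 - 2 = n.-1)%N; last lia.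
  rewrite big_mkord.
  elim/big_ind2 : _ => [|x1 x2 y1 y2 h1 h2|i _]; first by rewrite cards0.
    by rewrite (leq_trans (leq_card_setU _ _))// leq_add.
  by rewrite cardsX card_multiples// addn2.
rewrite -(ler_nat rat) natr_sum => /le_trans/(_ (sum_floor_squares n _ n1)).
set c := #|C|; set s := #|(\bigcup_(_ < _) _)%SET| => hs hn.
rewrite -(ler_nat rat) natrX natrM.
move: hn; rewrite -(ler_nat rat) natrD natrM -expr2.
have : 0 <= n%:R ^+ 2 * n%:R^-1 :> rat by rewrite mulr_ge0 ?exprn_ge0 ?invr_ge0.
move: hs; rewrite mulrBr; set x := n%:R ^+ 2; set y := x * n%:R^-1; lra.
Qed.

(** The numbers y/(x + y) with x, y <= n coprime are distinct, and distinct fractions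
with denominators at most 2n differ by at least 1/(2n)^2.  This choice of fractions
makes the count a count of coprime pairs in a full square, free of error terms. *)
Lemma farey_family (F : realFieldType) (n : nat) : exists (N : nat) (c b : nat -> nat),
  [/\ (n ^ 2 <= 4 * N)%N,
      (forall i, (i < N)%N -> [/\ 0 < b i, b i <= 2 * n & c i < b i]%N) &
      (forall i j, (i <= j)%N -> (j < N)%N ->
        (j - i)%:R / (2 * n)%:R ^+ 2 <= (c j)%:R / (b j)%:R - (c i)%:R / (b i)%:R :> F)].
Proof.
pose C := [set xy : 'I_n * 'I_n | coprime xy.1.+1 xy.2.+1]%SET.
pose g (xy : 'I_n * 'I_n) := (xy.2.+1, xy.1.+1 + xy.2.+1)%N.
pose f (u : nat * nat) : F := u.1%:R / u.2%:R.
pose l := sort (relpre f <=%O) (map g (enum C)).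
have lf : map f l = sort <=%O (map f (map g (enum C))) by rewrite sort_map.
have fE u v : (0 < u.2)%N -> (0 < v.2)%N -> f v - f u = ((v.1 * u.2)%:R - (u.1 * v.2)%:R) / (v.2%:R * u.2%:R).
  by move=> u0 v0; rewrite /f !natrM; field; rewrite !pnatr_eq0 -!lt0n u0 v0.
have uf : uniq (map f l).
  rewrite lf sort_uniq -map_comp map_inj_in_uniq ?enum_uniq//.
  move=> [x y] [x' y']; rewrite !mem_enum !inE /= => cxy cxy' /eqP.
  rewrite -subr_eq0 fE//= mulf_eq0 invr_eq0 -natrM pnatr_eq0/= orbF subr_eq0 eqr_nat => e.
  have e' : (x.+1 * y'.+1 = x'.+1 * y.+1)%N.
    move/eqP: e; move: (x.+1) (y.+1) (x'.+1) (y'.+1) => a b c d.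
    by rewrite !mulnDr (mulnC b d) => /addIn bc; rewrite mulnC -bc mulnC.
  have d1 : (x.+1 %| x'.+1)%N by rewrite -(Gauss_dvdl _ cxy) -e' dvdn_mulr.
  have d2 : (x'.+1 %| x.+1)%N by rewrite -(Gauss_dvdl _ cxy') e' dvdn_mulr.
  have xx : x.+1 = x'.+1 by apply/eqP; rewrite eqn_dvd d1.
  have yy : y.+1 = y'.+1 by move/eqP: e'; rewrite xx eqn_pmul2l// => /eqP.
  by congr pair; apply: val_inj => /=; lia.
have sf : sorted <%O (map f l).
  by rewrite lt_sorted_uniq_le uf lf sort_sorted//; exact: le_total.
have sl : size l = #|C| by rewrite size_sort size_map cardE.
have lP i : (i < size l)%N -> [/\ 0 < (nth (0, 1) l i).2, (nth (0, 1) l i).2 <= 2 * n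
    & (nth (0, 1) l i).1 < (nth (0, 1) l i).2]%N.
  move=> il; have := mem_nth (0%N, 1%N) il; rewrite mem_sort => /mapP[[x y] _ ->] /=.
  by have := ltn_ord x; have := ltn_ord y; split; lia.
exists #|C|, (fun i => (nth (0, 1)%N l i).1), (fun i => (nth (0, 1)%N l i).2); split.
- exact: card_coprime_pairs.
- by rewrite -sl.
move=> i j; rewrite -sl -!/(f _); elim: j => [|j IH].
  by rewrite leqn0 => /eqP -> _; rewrite subnn mul0r subrr.
rewrite leq_eqVlt => /orP[/eqP -> _|]; first by rewrite subnn mul0r subrr.
rewrite ltnS => ij jl; have jl' := ltnW jl.
rewrite subSn// -natr1 mulrDl -[X in _ <= X](subrKA (f (nth (0, 1)%N l j))) addrC.
apply: lerD; last exact: IH.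
have := lt_sorted_ltn_nth 0 sf; rewrite size_map => /(_ j j.+1 jl' jl).
rewrite ltnSn !(nth_map (0, 1)%N)// -subr_gt0.
have [u1 u2 u3] := lP _ jl'; have [v1 v2 v3] := lP _ jl.
rewrite fE// -!natrM; move: (nth _ l j) (nth _ l j.+1) u1 u2 u3 v1 v2 v3 => u v u1 u2 u3 v1 v2 v3.
have pos : 0 < (v.2 * u.2)%:R :> F by rewrite ltr0n muln_gt0 v1 u1.
rewrite pmulr_lgt0 ?invr_gt0// subr_gt0 ltr_nat => uv.
apply: ler_pM; rewrite ?invr_ge0 ?sqr_ge0//.
  by rewrite lerBrDr addrC natr1 ler_nat.
rewrite lef_pV2 ?posrE// -?natrX ?ltr0n ?ler_nat.
  by rewrite expnS expn1 leq_mul.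
by rewrite expn_gt0; apply/orP; left; lia.
Qed.

(** * Cantor sets as images of the unit interval *)

(** Level k of the Cantor set consists of cells of the grid of step 1/w_k.  Each
cell keeps N_k of its r_k subcells, at the positions d_k(0) < d_k(1) < ...  The
unit interval is cut accordingly into [cells k] intervals of equal length, and
[address k t] is the position in the grid of the cell matched with the t-th of
them. *)
Section CantorMap.
Variables (R : realType) (w r N : nat -> nat) (d : nat -> nat -> nat).

Definition cells (k : nat) : nat := (\prod_(l < k) N l)%N.

Definition cell_index (u : R) (k : nat) : nat := Num.truncn (u * (cells k)%:R).

Fixpoint address (k t : nat) : nat :=
  if k is k'.+1 then (address k' (t %/ N k') * r k' + d k' (t %% N k'))%N else 0%N.

Hypotheses (w0 : w 0 = 1%N) (wS : forall k, w k.+1 = (w k * r k)%N).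
Hypothesis N2 : forall k, (1 < N k)%N.
Hypothesis dr : forall k i, (i < N k)%N -> (d k i < r k)%N.
(* Up to the factor 32, kept subcells are separated as if they were equally
   spaced; the -1 accounts for the width of a subcell. *)
Hypothesis gap : forall k i j, (i < j)%N -> (j < N k)%N ->
  ((j - i) * r k <= 32 * N k * (d k j - d k i - 1))%N.

Lemma cellsS k : cells k.+1 = (cells k * N k)%N.
Proof. by rewrite /cells big_ord_recr. Qed.

Lemma cells_gt k : (k < cells k)%N.
Proof.
elim: k => [|k IH]; first by rewrite /cells big_ord0.
rewrite cellsS (@leq_trans (cells k * 2))//; last by rewrite leq_mul2l N2 orbT.
by rewrite muln2 -addnn -addn1 leq_add// (leq_ltn_trans _ IH).
Qed.

Lemma grid_gt0 k : (0 < w k)%N.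
Proof.
elim: k => [|k IH]; first by rewrite w0.
by rewrite wS muln_gt0 IH (leq_ltn_trans _ (dr _ _ (ltnW (N2 k)))).
Qed.

Lemma cell_indexS (u : R) k : 0 <= u -> (cell_index u k.+1 %/ N k)%N = cell_index u k.
Proof.
move=> u0; symmetry; apply: truncn_def.
have N0 : 0 < (N k)%:R :> R by rewrite ltr0n; exact: ltnW.
have : (cell_index u k.+1)%:R <= u * (cells k.+1)%:R < (cell_index u k.+1).+1%:R.
  by apply: truncn_itv; rewrite mulr_ge0.
set t := cell_index _ _; rewrite cellsS natrM mulrA => /andP[lo hi].
apply/andP; split; rewrite -(ler_pM2r N0, ltr_pM2r N0) -natrM.
  by rewrite (le_trans _ lo)// ler_nat leq_divM.
by rewrite (lt_le_trans hi)// ler_nat ltn_ceil//; exact: ltnW.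
Qed.

Lemma cell_index_lt (u : R) k : 0 <= u < 1 -> (cell_index u k < cells k)%N.
Proof.
move=> /andP[u0 u1]; rewrite truncn_lt_nat ?mulr_ge0//.
by rewrite gtr_pMl// ltr0n (leq_ltn_trans _ (cells_gt k)).
Qed.

Lemma address_lt k t : (t < cells k)%N -> (address k t < w k)%N.
Proof.
elim: k t => [|k IH] t /=; first by rewrite w0.
rewrite cellsS => tM; have N0 : (0 < N k)%N by apply: ltnW.
have := IH (t %/ N k)%N; rewrite ltn_divLR// => /(_ tM).
by have := dr _ _ (ltn_pmod t N0); rewrite wS; nia.
Qed.

Lemma cantor_map_exists : exists X : R -> R, forall (u : R) k,
  0 <= u -> (address k (cell_index u k))%:R / (w k)%:R <= X u <= (address k (cell_index u k)).+1%:R / (w k)%:R.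
Proof.
suff /choice [X XP] : forall u : R, exists x : R, forall k, 0 <= u ->
    (address k (cell_index u k))%:R / (w k)%:R <= x <= (address k (cell_index u k)).+1%:R / (w k)%:R.
  by exists X.
move=> u; have [u0|u0] := leP 0 u; last by exists 0 => k.
have wpos k : 0 < (w k)%:R :> R by rewrite ltr0n grid_gt0.
have [x xP] : exists x : R, forall k, (address k (cell_index u k))%:R / (w k)%:R <= x
    <= (address k (cell_index u k))%:R / (w k)%:R + (w k)%:R^-1.
  have dr' k := dr _ _ (ltn_pmod (cell_index u k.+1) (ltnW (N2 k))).
  apply: nested_intervals => k; first by rewrite invr_ge0 ltW.
    rewrite /= cell_indexS// ler_pdivlMr// mulrAC ler_pdivrMr// wS -!natrM ler_nat.
    by nia.
  rewrite -[X in _ + X]mul1r -[X in _ <= _ + X]mul1r -!mulrDl !natr1 /= cell_indexS//.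
  rewrite ler_pdivlMr// mulrAC ler_pdivrMr// wS -!natrM ler_nat.
  by move: (dr' k); nia.
by exists x => k _; rewrite -natr1 mulrDl mul1r.
Qed.

(** Let k be the last level at which u and v lie in the same interval, let z be the
number of subintervals of level k+1 between them divided by N_k, and let M_k be the
number of cells.  Then v - u is at most 2 z / M_k while X v - X u is at least
z / (32 w_k) by [gap]; as z <= z^s, the bound w_k^s <= K M_k gives the claim. *)
Lemma cantor_map_holder (X : R -> R) (s K u v : R) :
  (forall u k, 0 <= u -> (address k (cell_index u k))%:R / (w k)%:R <= X u
     <= (address k (cell_index u k)).+1%:R / (w k)%:R) ->
  0 <= s <= 1 -> (forall k, (w k)%:R `^ s <= K * (cells k)%:R) ->
  0 <= u -> u < v -> v < 1 -> v - u <= 64 * K * `|X v - X u| `^ s.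
Proof.
have arith (x a b : nat) : (a < b)%N -> ((x + b).+1 <= 2 * (b - a) + (x + a))%N by lia.
move=> XP /andP[s0 s1] KP u0 uv v1; have v0 : 0 <= v by rewrite (le_trans u0)// ltW.
have Mpos k : 0 < (cells k)%:R :> R by rewrite ltr0n (leq_ltn_trans _ (cells_gt k)).
(* There are more than k intervals of level k, so a level k with
   k + 1 > 1/(v - u) separates u from v. *)
have [k0 k0P] : exists k, cell_index u k != cell_index v k.
  pose k := Num.truncn (v - u)^-1; exists k; rewrite neq_ltn; apply/orP; left.
  have vuk : 1 <= v * (cells k)%:R - u * (cells k)%:R.
    rewrite -mulrBl mulrC -ler_pdivrMr ?subr_gt0// mul1r.
    rewrite (le_trans (ltW (truncnS_gt _)))// ler_nat; exact: cells_gt.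
  rewrite /cell_index -(ltr_nat R).
  have /andP[a1 a2] : (cell_index u k)%:R <= u * (cells k)%:R < (cell_index u k).+1%:R.
    by apply: truncn_itv; rewrite mulr_ge0.
  have /andP[b1 b2] : (cell_index v k)%:R <= v * (cells k)%:R < (cell_index v k).+1%:R.
    by apply: truncn_itv; rewrite mulr_ge0.
  move: b2; rewrite -natr1 /cell_index in a1 a2 *; lra.
have [[|k] kP kmin] := ex_minnP (ex_intro (fun k => cell_index u k != cell_index v k) k0 k0P).
  have := @cell_index_lt u 0%N; have := @cell_index_lt v 0%N.
  rewrite v0 u0 v1 (lt_trans uv v1) /cells big_ord0 !ltnS !leqn0 => /(_ isT)/eqP v0' /(_ isT)/eqP u0'.
  by rewrite v0' u0' eqxx in kP.
have tE : cell_index v k = cell_index u k.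
  by apply/eqP; apply: contraT; rewrite eq_sym => /kmin; rewrite ltnn.
have N0 : (0 < N k)%N by exact: ltnW.
have uvle : (cell_index u k.+1 <= cell_index v k.+1)%N.
  by apply: le_truncn; rewrite ler_wpM2r// ltW.
have := cell_indexS _ k v0; rewrite tE => tv; have tu := cell_indexS _ k u0.
have := XP u k.+1 u0; have := XP v k.+1 v0; rewrite /= tv tu.
set t := cell_index u k in tv tu *.
set U := cell_index u k.+1 in kP uvle tu *; set V := cell_index v k.+1 in kP uvle tv *.
set i := (U %% N k)%N; set j := (V %% N k)%N.
have UE : U = (t * N k + i)%N by rewrite -tu; exact: divn_eq.
have VE : V = (t * N k + j)%N by rewrite -tv; exact: divn_eq.
have jN : (j < N k)%N by rewrite ltn_pmod.
have ij : (i < j)%N by move: kP uvle; rewrite UE VE; lia.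
have r0 : (0 < r k)%N by rewrite (leq_ltn_trans _ (dr _ _ N0)).
have := gap _ _ _ ij jN; set D := (d k j - d k i - 1)%N => hgap.
have hD : (D + d k i + 1 = d k j)%N.
  suff : (0 < D)%N by rewrite /D; lia.
  rewrite lt0n; apply/eqP => D0; move: hgap; rewrite D0 muln0 leqn0 muln_eq0 subn_eq0.
  by rewrite leqNgt ij /= eqn0Ngt r0.
have [NR wR] : 0 < (N k)%:R :> R /\ 0 < (w k)%:R :> R by rewrite !ltr0n grid_gt0.
have rR : 0 < (r k)%:R :> R by rewrite ltr0n.
pose z : R := (j - i)%:R / (N k)%:R.
have z0 : 0 < z by rewrite divr_gt0 ?ltr0n ?subn_gt0.
have z1 : z <= 1 by rewrite ler_pdivrMr// mul1r ler_nat (leq_trans (leq_subr _ _))// ltnW.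
move=> /andP[Xv _] /andP[_ Xu].
have Xuv : z / (32 * (w k)%:R) <= X v - X u.
  rewrite (le_trans _ (lerB Xv Xu))// -mulrBl -hD.
  have -> : (address k t * r k + (D + d k i + 1))%:R - (address k t * r k + d k i).+1%:R = D%:R :> R.
    by rewrite -addn1 !natrD; ring.
  rewrite wS natrM ler_pdivlMr ?mulr_gt0//.
  have -> : z / (32 * (w k)%:R) * ((w k)%:R * (r k)%:R) = (j - i)%:R * (r k)%:R / (32 * (N k)%:R).
    by rewrite /z; field; rewrite !gt_eqF.
  by rewrite ler_pdivrMr ?mulr_gt0// mulrC -!natrM ler_nat mulnC [leqRHS]mulnC.
have vub : v - u <= 2 * (z / (cells k)%:R).
  have -> : 2 * (z / (cells k)%:R) = (2 * (j - i))%:R / (cells k.+1)%:R.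
    by rewrite /z cellsS !natrM; field; rewrite !gt_eqF.
  rewrite ler_pdivlMr// mulrBl.
  have /andP[a1 a2] : U%:R <= u * (cells k.+1)%:R < U.+1%:R.
    by apply: truncn_itv; rewrite mulr_ge0.
  have /andP[b1 b2] : V%:R <= v * (cells k.+1)%:R < V.+1%:R.
    by apply: truncn_itv; rewrite mulr_ge0.
  rewrite (le_trans (lerB (ltW b2) a1))// lerBlDr -natrD ler_nat UE VE; exact: arith.
have zs : z <= z `^ s by apply: ger1_powR => //; rewrite z0 z1.
have W0 : 0 < (32 * (w k)%:R) `^ s :> R by rewrite powR_gt0// mulr_gt0.
have Xs : z / (32 * (w k)%:R) `^ s <= `|X v - X u| `^ s.
  rewrite (@le_trans _ _ ((z / (32 * (w k)%:R)) `^ s))//.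
    have <- : z `^ s / (32 * (w k)%:R) `^ s = (z / (32 * (w k)%:R)) `^ s.
      have w32 : 0 < 32 * (w k)%:R :> R by rewrite mulr_gt0.
      move: (32 * (w k)%:R) w32 => b b0.
      have -> : z `^ s = (z / b) `^ s * b `^ s.
        by rewrite -powRM ?divfK ?gt_eqF ?divr_ge0 ?(ltW b0) ?(ltW z0).
      by rewrite mulfK// gt_eqF// powR_gt0.
    by rewrite ler_wpM2r// invr_ge0 powR_ge0.
  apply: ge0_ler_powR; rewrite ?nnegrE//.
    by rewrite divr_ge0 ?mulr_ge0// ltW.
  by rewrite (le_trans Xuv)// ler_norm.
have W32 : (32 * (w k)%:R) `^ s <= 32 * (K * (cells k)%:R).
  rewrite powRM//; apply: ler_pM; rewrite ?powR_ge0//.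
  by rewrite ler1_powR// ler1n.
have K0 : 0 < K.
  rewrite -(pmulr_lgt0 _ (Mpos k)) (lt_le_trans _ (KP k))// powR_gt0//.
rewrite (le_trans vub)// -mulrA.
have -> : 2 * (z / (cells k)%:R) = 64 * (K * (z / (32 * (K * (cells k)%:R)))).
  by field; rewrite !gt_eqF.
rewrite ler_pM2l// ler_pM2l// (le_trans _ Xs)//.
by rewrite ler_wpM2l ?(ltW z0)// lef_pV2 ?posrE ?mulr_gt0.
Qed.
End CantorMap.

(** * Hausdorff measures *)

Lemma diam_ge0 (R : realType) (n : nat) (A : set 'rV[R]_n) : (0 <= diam A)%E.
Proof. by apply: ereal_sup_ubound; left. Qed.

Lemma diam_set0 (R : realType) (n : nat) : diam (set0 : set 'rV[R]_n) = 0%E.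
Proof.
apply/eqP; rewrite eq_le diam_ge0 andbT; apply: ge_ereal_sup => y [->//|].
by move=> [p [[]]].
Qed.

Lemma diam_le (R : realType) (n : nat) (A : set 'rV[R]_n) (d : R) : 0 <= d ->
  (forall p q, A p -> A q -> euclidean_norm (p - q) <= d) -> (diam A <= d%:E)%E.
Proof.
move=> d0 Ad; apply: ge_ereal_sup => y [->|[[p q] [/= Ap Aq] <-]]; rewrite lee_fin//.
exact: Ad.
Qed.

Lemma euclidean_norm_le_diam (R : realType) (n : nat) (A : set 'rV[R]_n) (p q : 'rV[R]_n) :
  (diam A < +oo)%E -> A p -> A q -> euclidean_norm (p - q) <= fine (diam A).
Proof.
move=> Afin Ap Aq; rewrite -lee_fin fineK ?ge0_fin_numE ?diam_ge0//.
by apply: ereal_sup_ubound; right; exists (p, q).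
Qed.

(** The finite cover is enumerated and padded with empty sets, which cost h 0 = 0. *)
Lemma hausdorff_content_le_card (R : realType) (n : nat) (h : R -> R) (delta d : R)
    (E : set 'rV[R]_n) (T : finType) (F : T -> set 'rV[R]_n) :
  dimension_function h -> 0 <= d -> d < delta ->
  (forall t, (diam (F t) <= d%:E)%E) -> (forall p, E p -> exists t, F t p) ->
  (hausdorff_content h delta E <= (#|T|%:R * h d)%:E)%E.
Proof.
move=> [h0 hmono _ h00] d0 dd Fd EF.
pose G (i : nat) := if insub i : {? i | (i < #|T|)%N} is Some j then F (enum_val (Ordinal (svalP j))) else set0.
have GE (j : 'I_#|T|) : G j = F (enum_val j).
  rewrite /G insubT//= => jT; congr (F (enum_val _)); exact: val_inj.
have G0 i : (#|T| <= i)%N -> G i = set0 by move=> Ti; rewrite /G insubF// ltnNge Ti.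
have Gd i : (diam (G i) <= d%:E)%E.
  have [iT|/G0 ->] := ltnP i #|T|; last by rewrite diam_set0 lee_fin.
  by rewrite (GE (Ordinal iT)).
have fd i : 0 <= fine (diam (G i)) by rewrite fine_ge0// diam_ge0.
apply: (@le_trans _ _ (\sum_(0 <= i <oo) (h (fine (diam (G i))))%:E)%E).
  apply: ereal_inf_lbound; exists G => //; split; last first.
    by move=> i; rewrite (le_lt_trans (Gd i))// lte_fin.
  by move=> p /EF[t Ftp]; exists (enum_rank t : nat) => //; rewrite GE enum_rankK.
rewrite (nneseries_split 0 #|T|); last by move=> k _; rewrite lee_fin h0.
rewrite eseries0 ?adde0 ?add0n; last first.
  by move=> i Ti _; rewrite G0// diam_set0 /= h00.
rewrite sumEFin lee_fin big_mkord.
apply: (@le_trans _ _ (\sum_(i < #|T|) h d)); last by rewrite sumr_const card_ord mulr_natl.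
apply: ler_sum => i _; apply: hmono => //.
by rewrite -lee_fin fineK ?ge0_fin_numE ?diam_ge0// (le_lt_trans (Gd i))// ltry.
Qed.

Lemma hausdorff_content_ge0 (R : realType) (n : nat) (h : R -> R) (delta : R)
    (E : set 'rV[R]_n) : (forall x, 0 <= x -> 0 <= h x) ->
  (0 <= hausdorff_content h delta E)%E.
Proof.
move=> h0; apply/ereal_infP => _ [F _ <-].
by apply: nneseries_ge0 => i _ _; rewrite lee_fin h0// fine_ge0// diam_ge0.
Qed.

Lemma hausdorff_measure_eq0 (R : realType) (n : nat) (h : R -> R) (E : set 'rV[R]_n) :
  dimension_function h ->
  (forall eps : R, 0 < eps -> exists (T : finType) (F : T -> set 'rV[R]_n) (d : R),
    [/\ 0 <= d < eps, forall t, (diam (F t) <= d%:E)%E,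
        forall p, E p -> exists t, F t p & #|T|%:R * h d <= eps]) ->
  hausdorff_measure h E = 0%E.
Proof.
move=> hh cov; have h0 : forall x, 0 <= x -> 0 <= h x by case: hh.
apply/eqP; rewrite eq_le; apply/andP; split; last first.
  rewrite (le_trans (hausdorff_content_ge0 _ _ _ 1 E h0))//.
  by apply: ereal_sup_ubound; exists 1 => //=.
apply: ge_ereal_sup => _ [delta /= d0 <-]; apply/lee_addgt0Pr => e e0.
have e'0 : 0 < Num.min e delta by rewrite lt_min e0.
have [T [F [d [/andP[d1 d2] Fd EF he]]]] := cov _ e'0.
rewrite add0e (le_trans (hausdorff_content_le_card _ _ _ _ d _ _ F hh d1 _ Fd EF))//.
  by rewrite (lt_le_trans d2)// ge_min lexx orbT.
by rewrite lee_fin (le_trans he)// ge_min lexx.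
Qed.

(** If a cover F of E had small cost then the preimages of the F i would cover [0, 1[
by sets of diameter at most K (diam (F i))^s, of total length less than 1. *)
Lemma hausdorff_measure_powR_neq0 (R : realType) (n : nat) (s K : R) (E : set 'rV[R]_n)
    (x : R -> 'rV[R]_n) : 0 <= s -> 0 < K ->
  (forall u, 0 <= u < 1 -> E (x u)) ->
  (forall u v, 0 <= u -> u < v -> v < 1 ->
     v - u <= K * euclidean_norm (x v - x u) `^ s) ->
  hausdorff_measure (fun r => r `^ s) E <> 0%E.
Proof.
move=> s0 K0 xE xK H0.
have : (hausdorff_content (fun r : R => (r `^ s)%R) 1 E < ((4 * K)^-1)%:E)%E.
  rewrite (@le_lt_trans _ _ 0%E) ?lte_fin ?invr_gt0 ?mulr_gt0// -H0.
  by apply: ereal_sup_ubound; exists 1 => //=.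
move=> /ereal_inf_lt[_ [F [EF Fd] <-]] small.
pose t i := K * fine (diam (F i)) `^ s.
have t0 i : 0 <= t i by rewrite mulr_ge0 ?powR_ge0// ltW.
have /choice[c cP] : forall i, exists c, forall u, 0 <= u < 1 -> F i (x u) ->
    c - t i <= u <= c + t i.
  (* Any point of the preimage of F i serves as a centre. *)
  move=> i; have [[c [c01 Fc]]|nF] := pselect (exists c, 0 <= c < 1 /\ F i (x c)); last first.
    by exists 0 => u u01 Fu; case: nF; exists u.
  have far u v : 0 <= u -> u < v -> v < 1 -> F i (x u) -> F i (x v) -> v - u <= t i.
    move=> u0 uv v1 Fu Fv; rewrite (le_trans (xK _ _ u0 uv v1))// /t ler_pM2l//.
    apply: ge0_ler_powR => //; rewrite ?nnegrE ?sqrtr_ge0 ?fine_ge0 ?diam_ge0//.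
    by apply: euclidean_norm_le_diam => //; rewrite (lt_trans (Fd i))// ltry.
  exists c => u /andP[u0 u1] Fu; case/andP: c01 => c0 c1.
  have ti := t0 i.
  have [uc|cu|->] := ltgtP u c; last by apply/andP; split; lra.
    by have := far _ _ u0 uc c1 Fu Fc => ?; apply/andP; split; lra.
  by have := far _ _ c0 cu u1 Fc Fu => ?; apply/andP; split; lra.
have cov : `[0, 1[%classic `<=` \bigcup_i `[c i - t i, c i + t i]%classic.
  move=> u /=; rewrite in_itv/= => u01; have [i _ Fi] := EF _ (xE _ u01).
  by exists i => //=; rewrite in_itv/= cP.
have : (@lebesgue_measure R `[0%R, 1%R[%classic <= \sum_(0 <= i <oo)
    @lebesgue_measure R `[(c i - t i)%R, (c i + t i)%R]%classic)%E.
  by apply: measure_sigma_subadditive => // i; exact: measurable_itv.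
rewrite lebesgue_measure_itv/= lte_fin ltr01 oppr0 adde0 leNgt => /negP; apply.
apply: (@le_lt_trans _ _ (\sum_(0 <= i <oo) ((2 * K)%:E * (fine (diam (F i)) `^ s)%:E))%E).
  apply: lee_nneseries => [i _ _|i _]; first exact: measure_ge0.
  rewrite lebesgue_measure_itv/= lte_fin; case: ifP => _; rewrite -?EFinB ?EFinM ?lee_fin -?EFinM ?lee_fin.
    by rewrite /t; lra.
  by rewrite mulr_ge0 ?powR_ge0 ?mulr_ge0// ltW.
rewrite nneseriesZl => [|i _]; last by rewrite lee_fin powR_ge0.
apply: (@le_lt_trans _ _ ((2 * K)%:E * ((4 * K)^-1)%:E)%E).
  by rewrite lee_wpmul2l// ?lee_fin ?mulr_ge0 ?ltW.
rewrite -EFinM lte_fin (_ : 2 * K * (4 * K)^-1 = 2^-1); first lra.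
by field; rewrite gt_eqF.
Qed.

(** * The scales *)

(** The quotient of h x by the power is log(1/x)^(-theta), which tends to 0. *)
Lemma gauge_small (R : realType) (alpha theta C : R) (h : R -> R) :
  0 < theta -> is_htheta alpha theta h -> 0 < C ->
  exists2 x0 : R, 0 < x0 & forall x, 0 < x < x0 -> C * h x <= x `^ ((1 + 3 * alpha) / 2).
Proof.
move=> th0 [_ hx] C0.
have [e /= e0 he] : exists2 e : R, 0 < e & forall x, 0 < x < e -> h x = htheta_formula alpha theta x.
  have [e /= e0 he] := hx; exists e => // x /andP[x0 xe].
  by apply: he => //=; rewrite sub0r normrN gtr0_norm.
exists (Num.min e (expR (- C `^ theta^-1))); first by rewrite lt_min e0 expR_gt0.
move=> x /andP[x0]; rewrite lt_min => /andP[xe xC].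
rewrite he ?x0// /htheta_formula mulrCA -[leRHS]mulr1 ler_wpM2l ?powR_ge0//.
have lnx : C `^ theta^-1 <= ln x^-1.
  by rewrite lnV ?posrE// lerNr -[leRHS]expRK ler_ln ?posrE ?expR_gt0// ltW.
have lnx0 : 0 < ln x^-1 by rewrite (lt_le_trans _ lnx)// powR_gt0.
rewrite powRN ler_pdivrMr ?powR_gt0// mul1r.
have -> : C = (C `^ theta^-1) `^ theta.
  by rewrite -powRrM mulVf ?gt_eqF// powRr1// ltW.
by apply: ge0_ler_powR => //; rewrite ?nnegrE ?powR_ge0// ltW.
Qed.

(** With x = 34 D / m^2, the power x^((1 + 3 alpha)/2) is a constant times
1/(m m^(3 alpha)), so the cost is a constant times the factor of [gauge_small]. *)
Lemma cover_cost_small (R : realType) (alpha theta eps : R) (h : R -> R) (w D : nat) :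
  0 < alpha -> 0 < theta -> is_htheta alpha theta h -> (0 < w)%N -> (0 < D)%N -> 0 < eps ->
  exists B : nat, forall m, (B <= m)%N ->
    (378 * w ^ 2 * m)%:R * m%:R `^ (3 * alpha) * h ((34 * D)%:R / m%:R ^+ 2) <= eps /\
    (34 * D)%:R / m%:R ^+ 2 < eps.
Proof.
move=> a0 th0 hh w0 D0 e0.
set b := (1 + 3 * alpha) / 2.
have D'0 : 0 < (34 * D)%:R :> R by rewrite ltr0n muln_gt0.
have w'0 : 0 < (378 * w ^ 2)%:R :> R by rewrite ltr0n muln_gt0/= expn_gt0 w0.
pose C := (378 * w ^ 2)%:R * (34 * D)%:R `^ b / eps.
have C0 : 0 < C by rewrite divr_gt0 ?mulr_gt0 ?powR_gt0.
have [x0 x00 hx0] := gauge_small _ _ _ _ _ th0 hh C0.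
pose x1 := Num.min x0 eps.
have x10 : 0 < x1 by rewrite lt_min x00.
exists (Num.truncn ((34 * D)%:R / x1)).+1 => m mB.
have mx1 : (34 * D)%:R / x1 < m%:R by rewrite (lt_le_trans (truncnS_gt _))// ler_nat.
have m1 : 1 <= m%:R :> R by rewrite ler1n (leq_trans _ mB).
have m0 : 0 < m%:R :> R by rewrite (lt_le_trans ltr01).
set x := _ / m%:R ^+ 2.
have xpos : 0 < x by rewrite divr_gt0// exprn_gt0.
have : x < x1.
  rewrite ltr_pdivrMr ?exprn_gt0//; rewrite ltr_pdivrMr// in mx1.
  by rewrite (lt_le_trans mx1)// mulrC ler_pM2l// expr2 ler_peMl// ltW.
rewrite lt_min => /andP[xx0 xe]; split => //.
have xm : x `^ b * (m%:R * m%:R `^ (3 * alpha)) = (34 * D)%:R `^ b.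
  have -> : m%:R * m%:R `^ (3 * alpha) = (m%:R ^+ 2) `^ b :> R.
    rewrite -(powR_mulrn 2) ?ltW// -powRrM /b mulrCA divff ?mulr1 ?pnatr_eq0//.
    by rewrite powRD ?powRr1 ?ltW// (gt_eqF m0) implybT.
  by rewrite -powRM ?ltW ?exprn_gt0// divfK// gt_eqF// exprn_gt0.
have := hx0 x; rewrite xpos xx0 => /(_ isT).
rewrite -(ler_pM2r (_ : 0 < m%:R * m%:R `^ (3 * alpha))) ?mulr_gt0 ?powR_gt0// xm.
have -> : C * h x * (m%:R * m%:R `^ (3 * alpha)) = (34 * D)%:R `^ b *
    ((378 * w ^ 2 * m)%:R * m%:R `^ (3 * alpha) * h x / eps).
  by rewrite /C (natrM _ _ m); ring.
by rewrite -[X in _ <= X]mulr1 ler_pM2l ?powR_gt0// ler_pdivrMr// mul1r.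
Qed.

(** For s < alpha, a count of order m^(2 alpha) beats any constant times (m^2)^s. *)
Lemma truncn_powR_large (R : realType) (alpha s : R) (w : nat) :
  (0 < w)%N -> 0 < alpha <= 1 -> 0 <= s < alpha ->
  exists B : nat, forall m, (B <= m)%N ->
   [/\ (2 < Num.truncn (m%:R `^ alpha : R))%N, (Num.truncn (m%:R `^ alpha : R) <= m)%N &
       4 * (w * (16 * m ^ 2))%:R `^ s <= (Num.truncn (m%:R `^ alpha : R))%:R ^+ 2].
Proof.
move=> w0 /andP[a0 a1] /andP[s0 sa].
pose e := 2 * (alpha - s).
have e0 : 0 < e by rewrite mulr_gt0// subr_gt0.
have big (c t : R) : 0 <= c -> 0 < t -> exists B : nat, forall m, (B <= m)%N -> c <= m%:R `^ t.
  move=> c0 t0; exists (Num.truncn (c `^ t^-1)).+1 => m mB.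
  have -> : c = (c `^ t^-1) `^ t by rewrite -powRrM mulVf ?gt_eqF// powRr1.
  apply: ge0_ler_powR; rewrite ?nnegrE ?powR_ge0//; first exact: ltW.
  by rewrite (le_trans (ltW (truncnS_gt _)))// ler_nat.
have [B1 hB1] := big 3 _ (ler0n _ _) a0.
have [B2 hB2] := big (256 * w)%:R _ (ler0n _ _) e0.
exists (maxn (maxn B1 B2) 1) => m; rewrite !geq_max => /andP[/andP[/hB1 m3 /hB2 mw] m1].
have m1R : 1 <= m%:R :> R by rewrite ler1n.
have ma0 : 0 <= m%:R `^ alpha :> R by rewrite powR_ge0.
set n := Num.truncn _.
have /andP[n1 n2] : n%:R <= m%:R `^ alpha < n.+1%:R by exact: truncn_itv.
have n3 : (2 < n)%N by rewrite -ltnS -(ltr_nat R) (le_lt_trans m3).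
split => //.
  by rewrite -(ler_nat R) (le_trans n1)// ler1_powR.
have n4 : m%:R `^ alpha <= 2 * n%:R :> R.
  by rewrite (le_trans (ltW n2))// -natrM ler_nat mul2n -addnn -addn1 leq_add2l (leq_trans _ n3).
have n5 : (m%:R `^ alpha) ^+ 2 <= 4 * n%:R ^+ 2 :> R by nra.
suff : 16 * (w * (16 * m ^ 2))%:R `^ s <= (m%:R `^ alpha) ^+ 2 :> R by lra.
have -> : (m%:R `^ alpha) ^+ 2 = m%:R `^ e * (m%:R ^+ 2) `^ s :> R.
  rewrite -!powR_mulrn ?powR_ge0 ?ler0n// -!powRrM -powRD; last by rewrite pnatr_eq0 -lt0n m1 implybT.
  by congr (_ `^ _); rewrite /e; ring.
have -> : (w * (16 * m ^ 2))%:R = (16 * w)%:R * m%:R ^+ 2 :> R by rewrite !natrM; ring.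
rewrite powRM ?exprn_ge0// mulrA ler_wpM2r ?powR_ge0//.
rewrite (le_trans _ mw)//.
rewrite (@le_trans _ _ (16 * (16 * w)%:R))//; last by rewrite -natrM mulnA.
by rewrite ler_pM2l// ler1_powR ?ler1n ?muln_gt0// (le_trans (ltW sa)).
Qed.

Definition farey_order (R : realType) (alpha : R) (m : nat) : nat :=
  Num.truncn (m%:R `^ alpha).

(** At scale k+1 the lines have coefficients in multiples of 1/[line_den k.+1], up to
errors of order ([line_den k.+1])^-2 times constants from scale k, and the
abscissae are confined to cells of the grid of step 1/[cell_den k.+1].  The factor
2 [line_den k]^2 in [line_denS] makes the increments of the coefficient A at
scale k+1 smaller than ([line_den k])^-2.  The factor 378 [cell_den k]^2 and the
mesh 68 [line_den k]^2 / m^2 are those of the cover in [furstenberg_set_null].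
The exponents alpha - alpha/(k+1) increase to alpha, so that
[farey_order_large] eventually serves each s < alpha. *)
Record scale_system (R : realType) (alpha : R) (h : R -> R) := ScaleSystem {
  line_den : nat -> nat;
  cell_den : nat -> nat;
  pell_den : nat -> nat;
  line_den0 : line_den 0 = 1%N;
  cell_den0 : cell_den 0 = 1%N;
  line_denS : forall k, line_den k.+1 = (2 * line_den k ^ 2 * pell_den k)%N;
  cell_denS : forall k, cell_den k.+1 = (cell_den k * (16 * line_den k.+1 ^ 2))%N;
  pell_den_gt0 : forall k, (0 < pell_den k)%N;
  pell_denP : forall k, exists p, (p ^ 2 = 2 * pell_den k ^ 2 + 1)%N;
  cover_cost : forall k,
    (378 * cell_den k ^ 2 * line_den k.+1)%:R * (line_den k.+1)%:R `^ (3 * alpha)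
      * h ((68 * line_den k ^ 2)%:R / (line_den k.+1)%:R ^+ 2) <= k.+1%:R^-1;
  cover_mesh : forall k,
    (68 * line_den k ^ 2)%:R / (line_den k.+1)%:R ^+ 2 < k.+1%:R^-1 :> R;
  farey_order_gt2 : forall k, (2 < farey_order R alpha (line_den k.+1))%N;
  farey_order_le : forall k, (farey_order R alpha (line_den k.+1) <= line_den k.+1)%N;
  farey_order_large : forall k, 4 * (cell_den k.+1)%:R `^ (alpha - alpha / k.+1%:R)
    <= (farey_order R alpha (line_den k.+1))%:R ^+ 2
}.

Arguments line_den {R alpha h} _.
Arguments cell_den {R alpha h} _.
Arguments pell_den {R alpha h} _.
Arguments line_den0 {R alpha h} _.
Arguments cell_den0 {R alpha h} _.
Arguments line_denS {R alpha h} _.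
Arguments cell_denS {R alpha h} _.
Arguments pell_den_gt0 {R alpha h} _.
Arguments pell_denP {R alpha h} _.
Arguments cover_cost {R alpha h} _.
Arguments cover_mesh {R alpha h} _.
Arguments farey_order_gt2 {R alpha h} _.
Arguments farey_order_le {R alpha h} _.
Arguments farey_order_large {R alpha h} _.

(** Each scale is obtained from the previous one by taking a large solution of the
Pell equation. *)
Lemma scale_system_exists (R : realType) (alpha theta : R) (h : R -> R) :
  0 < alpha <= 1 -> 0 < theta -> is_htheta alpha theta h ->
  inhabited (scale_system R alpha h).
Proof.
move=> a01 th0 hh; have a0 : 0 < alpha by case/andP: a01.
have step (x : nat * (nat * nat)) : exists q : nat, let: (k, (m, w)) := x in
    (0 < m)%N -> (0 < w)%N -> let M := (2 * m ^ 2 * q)%N in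
    [/\ (0 < q)%N, exists p, (p ^ 2 = 2 * q ^ 2 + 1)%N,
        (378 * w ^ 2 * M)%:R * M%:R `^ (3 * alpha)
          * h ((68 * m ^ 2)%:R / M%:R ^+ 2) <= k.+1%:R^-1 /\
        (68 * m ^ 2)%:R / M%:R ^+ 2 < k.+1%:R^-1 :> R,
        (2 < farey_order R alpha M)%N /\ (farey_order R alpha M <= M)%N &
        4 * (w * (16 * M ^ 2))%:R `^ (alpha - alpha / k.+1%:R) <= (farey_order R alpha M)%:R ^+ 2].
  case: x => k [m w].
  have [m0|] := posnP m; first by exists 0%N.
  have [w0|] := posnP w; first by exists 0%N.
  move=> w0 m0.
  have D0 : (0 < 2 * m ^ 2)%N by rewrite muln_gt0/= expn_gt0 m0.
  have e0 : 0 < k.+1%:R^-1 :> R by rewrite invr_gt0.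
  have [B1 hB1] := cover_cost_small _ _ _ _ _ _ _ a0 th0 hh w0 D0 e0.
  have s01 : 0 <= alpha - alpha / k.+1%:R < alpha.
    rewrite subr_ge0 ler_piMr ?(ltW a0)//=; last by rewrite invf_le1 ?ltr0n// ler1n.
    by rewrite gtrBl divr_gt0.
  have [B2 hB2] := truncn_powR_large _ _ _ _ w0 a01 s01.
  have [p [q [pq Bq]]] := pell_unbounded (maxn 1 (maxn B1 B2)).
  exists q => _ _ M; move: Bq; rewrite !geq_max => /andP[q0 /andP[Bq1 Bq2]].
  have qM : (q <= M)%N by rewrite leq_pmull.
  have [c1 c2] := hB1 M (leq_trans Bq1 qM).
  have [f1 f2 f3] := hB2 M (leq_trans Bq2 qM).
  rewrite mulnA in c1 c2; split => //; by exists p.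
have [Q QP] := choice step.
(* The state is the pair (line_den, cell_den). *)
pose st := fix st k : nat * nat := if k is k'.+1 then
  let M := (2 * (st k').1 ^ 2 * Q (k', st k'))%N in (M, ((st k').2 * (16 * M ^ 2))%N)
  else (1, 1)%N.
have stS k : st k.+1 = (2 * (st k).1 ^ 2 * Q (k, st k),
  (st k).2 * (16 * (2 * (st k).1 ^ 2 * Q (k, st k)) ^ 2))%N by [].
have st0 k : (0 < (st k).1)%N /\ (0 < (st k).2)%N.
  elim: k => [//|k [m0 w0]]; have := QP (k, st k); rewrite stS.
  case: (st k) m0 w0 => m w /= m0 w0 /(_ m0 w0)[q0 _ _ _ _].
  by rewrite !(muln_gt0, expn_gt0) m0 w0 q0.
have good k := QP (k, st k).
constructor; apply: (@ScaleSystem _ _ _ (fun k => (st k).1) (fun k => (st k).2)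
  (fun k => Q (k, st k))) => // k; rewrite ?stS; have [] := st0 k; move: (good k);
  by case: (st k) => m w /= H m0 w0; have [? ? [? ?] [? ?] ?] := H m0 w0.
Qed.

Section ScaleSystem.
Variables (R : realType) (alpha : R) (h : R -> R) (S : scale_system R alpha h).

Local Notation m := (line_den S).
Local Notation w := (cell_den S).
Local Notation q := (pell_den S).
Local Notation n := (fun k => farey_order R alpha (m k.+1)).

Lemma line_den_gt0 k : (0 < m k)%N.
Proof.
elim: k => [|k IH]; first by rewrite line_den0.
by rewrite line_denS !muln_gt0 IH pell_den_gt0.
Qed.

Lemma cell_den_gt0 k : (0 < w k)%N.
Proof.
elim: k => [|k IH]; first by rewrite cell_den0.
by rewrite cell_denS !muln_gt0 IH !line_den_gt0.
Qed.

Lemma cell_den_homo k l : (k <= l)%N -> (w k <= w l)%N.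
Proof.
elim: l => [|l IH]; first by rewrite leqn0 => /eqP->.
rewrite leq_eqVlt => /orP[/eqP->//|/IH wkl].
by rewrite (leq_trans wkl)// cell_denS leq_pmulr// !muln_gt0 !line_den_gt0.
Qed.

(** Let A_k = J_k / m_k be the approximation at scale k.  Adding r / m_(k+1) to it,
with r < q_k given by [inhomogeneous_sqrt2], brings m_(k+1) (a + A_(k+1) sqrt 2)
within 2/q_k of an integer i.  The increment is less than 1/(2 m_k^2), so the A_k
converge and each is within m_k^-2 of the limit.  Starting from A_0 = 1 makes
a + A sqrt 2 nonnegative, hence approximable by natural numbers over m. *)
Lemma line_parameters (a : R) : -1 <= a <= 1 -> exists A : R, 1 <= A <= 2 /\
  forall k, exists j i : nat,
    `|A - j%:R / (m k.+1)%:R| <= ((m k.+1)%:R ^+ 2)^-1 /\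
    `|a + A * Num.sqrt 2 - i%:R / (m k.+1)%:R| <= (8 * m k ^ 2)%:R / (m k.+1)%:R ^+ 2.
Proof.
have arith (x : nat) : (0 < x)%N -> (4 * x + 2 <= 8 * x)%N by lia.
move=> /andP[a1 a2]; set t : R := Num.sqrt 2.
have tt : t ^+ 2 = 2 by rewrite sqr_sqrtr.
have t0 : 0 <= t by rewrite sqrtr_ge0.
have t1 : 1 <= t by nra.
have t2 : t <= 2 by nra.
have step (x : nat * nat) : exists r : nat, let: (k, J) := x in
    (m k <= J)%N -> (r < q k)%N /\ exists i : nat,
    `|(m k.+1)%:R * a + (J * (2 * m k * q k) + r)%:R * t - i%:R| <= 2 / (q k)%:R.
  case: x => k J; have [mJ|_] := leqP (m k) J; last by exists 0%N.
  have [p pq] := pell_denP S k.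
  pose beta := (m k.+1)%:R * a + (J * (2 * m k * q k))%:R * t.
  have [|r [i [rq hr]]] := inhomogeneous_sqrt2 R p (q k) beta (pell_den_gt0 S k) pq.
    have : (m k.+1)%:R <= (J * (2 * m k * q k))%:R :> R.
      rewrite ler_nat line_denS expnS expn1.
      by rewrite [X in (X <= _)%N](_ : _ = m k * (2 * m k * q k))%N ?leq_mul2r ?mJ ?orbT//; ring.
    rewrite /beta; have : 0 <= (m k.+1)%:R :> R by [].
    move: (m k.+1)%:R (J * _)%:R => x y x0 xy; nra.
  exists r => _; split => //; exists i.
  by rewrite natrD mulrDl addrA.
have [r rP] := choice step.
pose J := fix J k : nat := if k is k'.+1 then (J k' * (2 * m k' * q k') + r (k', J k'))%N else 1%N.
have JS k : J k.+1 = (J k * (2 * m k * q k) + r (k, J k))%N by [].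
have mS k : m k.+1 = (m k * (2 * m k * q k))%N by rewrite line_denS; ring.
have mJ k : (m k <= J k)%N.
  elim: k => [|k IH]; first by rewrite line_den0.
  by rewrite JS mS (leq_trans _ (leq_addr _ _))// leq_mul2r IH orbT.
have JP k := rP (k, J k) (mJ k).
have mR k : 0 < (m k)%:R :> R by rewrite ltr0n line_den_gt0.
have qR k : 0 < (q k)%:R :> R by rewrite ltr0n pell_den_gt0.
have AS k : (J k.+1)%:R / (m k.+1)%:R = (J k)%:R / (m k)%:R + (r (k, J k))%:R / (m k.+1)%:R :> R.
  by rewrite JS mS !natrD !natrM; field; rewrite !gt_eqF.
have [A AP] : exists A : R, forall k, (J k)%:R / (m k)%:R <= A <= (J k)%:R / (m k)%:R + ((m k)%:R ^+ 2)^-1.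
  apply: nested_intervals => k; first by rewrite invr_ge0 exprn_ge0.
    by rewrite AS lerDl divr_ge0.
  rewrite AS -addrA lerD2l.
  have [rq _] := JP k.
  have h1 : (r (k, J k))%:R / (m k.+1)%:R <= (2 * (m k)%:R ^+ 2)^-1 :> R.
    rewrite ler_pdivrMr// line_denS natrM (natrM _ 2) natrX mulKf ?ler_nat ?(ltnW rq)//.
    by rewrite gt_eqF// mulr_gt0// exprn_gt0.
  have h2 : ((m k.+1)%:R ^+ 2)^-1 <= (2 * (m k)%:R ^+ 2)^-1 :> R.
    rewrite lef_pV2 ?posrE ?mulr_gt0 ?exprn_gt0// -!natrX -natrM ler_nat.
    have mm : (2 * m k ^ 2 <= m k.+1)%N by rewrite line_denS leq_pmulr// pell_den_gt0.
    by rewrite (leq_trans mm)// expnS expn1 leq_pmulr// line_den_gt0.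
  rewrite (le_trans (lerD h1 h2))// invfM; lra.
exists A; split.
  have := AP 0%N; rewrite line_den0 /= expr1n !invr1 mulr1; lra.
move=> k; exists (J k.+1); have /andP[lo hi] := AP k.+1.
have [_ [i hi']] := JP k; exists i; split.
  have : 0 <= ((m k.+1)%:R ^+ 2)^-1 :> R by rewrite invr_ge0 exprn_ge0.
  by rewrite ler_norml => ?; apply/andP; split; lra.
have e1 : `|a + (J k.+1)%:R / (m k.+1)%:R * t - i%:R / (m k.+1)%:R| <= (4 * m k ^ 2)%:R / (m k.+1)%:R ^+ 2.
  have -> : a + (J k.+1)%:R / (m k.+1)%:R * t - i%:R / (m k.+1)%:R =
     ((m k.+1)%:R * a + (J k.+1)%:R * t - i%:R) / (m k.+1)%:R by field; rewrite gt_eqF.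
  rewrite normrM [X in _ * X]gtr0_norm ?invr_gt0// ler_pdivrMr//.
  rewrite (le_trans hi')// [X in _ <= X](_ : _ = 2 / (q k)%:R)//.
  by rewrite line_denS !natrM; field; rewrite !gt_eqF.
have -> : a + A * t - i%:R / (m k.+1)%:R = a + (J k.+1)%:R / (m k.+1)%:R * t - i%:R / (m k.+1)%:R
   + (A - (J k.+1)%:R / (m k.+1)%:R) * t by ring.
rewrite (le_trans (ler_normD _ _))//.
have e2 : `|(A - (J k.+1)%:R / (m k.+1)%:R) * t| <= 2 * ((m k.+1)%:R ^+ 2)^-1.
  rewrite ger0_norm ?mulr_ge0 ?subr_ge0// mulrC; apply: ler_pM => //; lra.
rewrite (le_trans (lerD e1 e2))// -mulrDl ler_wpM2r ?invr_ge0 ?exprn_ge0//.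
by rewrite -natrD ler_nat; apply: arith; rewrite expn_gt0 line_den_gt0.
Qed.

(** A cell [P/w, (P+1)/w] of level k contains the images (P + c/b)/w of the
fractions c/b of [farey_family], whose denominators w b are at most 2 w n; keep the
subcells containing them.  The relative width 1/r = 1/(16 m^2) of a subcell is at
most a quarter of the gaps 1/(4 n^2) between the fractions, as n <= m.  Since there are at
least n^2/4 subcells, [farey_order_large] bounds w_(k+1)^s by their number. *)
Lemma rational_cantor_set : 0 < alpha <= 1 -> exists X : R -> R,
  (forall u, 0 <= u < 1 -> 0 <= X u <= 1 /\ forall k, exists b p : nat,
     [/\ (0 < b <= 2 * n k)%N, (p <= w k * b)%N &
         `|X u - p%:R / (w k * b)%:R| <= ((m k.+1)%:R ^+ 2)^-1]) /\
  (forall s, 0 <= s < alpha -> exists2 K : R, 0 < K &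
     forall u v, 0 <= u -> u < v -> v < 1 -> v - u <= K * `|X v - X u| `^ s).
Proof.
move=> /andP[a0 a1].
pose FT := (nat * ((nat -> nat) * (nat -> nat)))%type.
have ex k : exists f : FT, let: (N, (c, b)) := f in
  [/\ (n k ^ 2 <= 4 * N)%N,
      (forall i, (i < N)%N -> [/\ 0 < b i, b i <= 2 * n k & c i < b i]%N) &
      (forall i j, (i <= j)%N -> (j < N)%N ->
        (j - i)%:R / (2 * n k)%:R ^+ 2 <= (c j)%:R / (b j)%:R - (c i)%:R / (b i)%:R :> R)].
  by have [N [c [b H]]] := farey_family R (n k); exists (N, (c, b)).
have [f fP] := choice ex.
pose N k := (f k).1; pose c k := (f k).2.1; pose b k := (f k).2.2.
have {}fP k : [/\ (n k ^ 2 <= 4 * N k)%N, 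
      (forall i, (i < N k)%N -> [/\ 0 < b k i, b k i <= 2 * n k & c k i < b k i]%N) &
      (forall i j, (i <= j)%N -> (j < N k)%N ->
        (j - i)%:R / (2 * n k)%:R ^+ 2 <= (c k j)%:R / (b k j)%:R - (c k i)%:R / (b k i)%:R :> R)].
  by move: (fP k); rewrite /N /c /b; case: (f k) => ? [? ?].
pose r k := (16 * m k.+1 ^ 2)%N.
pose d k i := ((r k * c k i) %/ b k i)%N.
have n3 k : (2 < n k)%N by exact: farey_order_gt2.
have nm k : (n k <= m k.+1)%N by exact: farey_order_le.
have wS k : w k.+1 = (w k * r k)%N by exact: cell_denS.
have N2 k : (1 < N k)%N.
  have [h1 _ _] := fP k; rewrite -(ltn_pmul2l (isT : 0 < 4)%N) (leq_trans _ h1)//.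
  by rewrite (@leq_trans (3 ^ 2)%N)// leq_exp2r.
have r0 k : (0 < r k)%N by rewrite !muln_gt0 !line_den_gt0.
have dlo k i : (i < N k)%N -> (d k i)%:R <= (r k)%:R * ((c k i)%:R / (b k i)%:R) :> R.
  have [_ h3 _] := fP k; move=> /h3[b0 _ _].
  by rewrite mulrA ler_pdivlMr ?ltr0n// -!natrM ler_nat leq_divM.
have dhi k i : (i < N k)%N -> (r k)%:R * ((c k i)%:R / (b k i)%:R) <= (d k i)%:R + 1 :> R.
  have [_ h3 _] := fP k; move=> /h3[b0 _ _].
  by rewrite mulrA ler_pdivrMr ?ltr0n// natr1 -!natrM ler_nat ltnW// ltn_ceil.
have dr k i : (i < N k)%N -> (d k i < r k)%N.
  have [_ h3 _] := fP k; move=> /h3[b0 _ cb].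
  by rewrite /d ltn_divLR// ltn_mul2l r0 cb.
(* By rounding, d_j - d_i - 1 >= r (j - i)/(4 n^2) - 2, and r >= 16 n^2 makes 2 at
   most half of the first term; finally 8 n^2 <= 32 N. *)
have gap k i j : (i < j)%N -> (j < N k)%N ->
    ((j - i) * r k <= 32 * N k * (d k j - d k i - 1))%N.
  move=> ij jN; have iN : (i < N k)%N by exact: ltn_trans jN.
  have [h1 _ /(_ i j (ltnW ij) jN)] := fP k.
  have := dlo k i iN; have := dhi k j jN.
  set x := _ / _; set y := _ / _ => xj yi hgap.
  have n0 : 0 < (n k)%:R :> R by rewrite ltr0n (leq_trans _ (n3 k)).
  have rn : 16 * (n k)%:R ^+ 2 <= (r k)%:R :> R.
    by rewrite -natrX -natrM ler_nat leq_mul2l/= leq_exp2r.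
  have e1 : 1 <= (j - i)%:R :> R by rewrite ler1n subn_gt0.
  have h2 : (j - i)%:R * (r k)%:R <= 8 * (n k)%:R ^+ 2 * ((d k j)%:R - (d k i)%:R - 1) :> R.
    have : (j - i)%:R * (r k)%:R <= 4 * (n k)%:R ^+ 2 * ((r k)%:R * (x - y)).
      rewrite ler_pdivrMr ?exprn_gt0 ?ltr0n ?muln_gt0 ?(leq_trans _ (n3 k))// in hgap.
      have -> : 4 * (n k)%:R ^+ 2 * ((r k)%:R * (x - y)) = ((x - y) * (2 * n k)%:R ^+ 2) * (r k)%:R.
        by rewrite natrM; ring.
      by rewrite ler_wpM2r.
    have : 16 * (n k)%:R ^+ 2 <= (j - i)%:R * (r k)%:R :> R.
      by rewrite (le_trans rn)// ler_peMl.
    have : 4 * (n k)%:R ^+ 2 * ((r k)%:R * (x - y)) <= 4 * (n k)%:R ^+ 2 * ((d k j)%:R + 1 - (d k i)%:R).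
      by rewrite ler_wpM2l ?mulr_ge0 ?exprn_ge0// mulrBr lerB.
    move: (_ ^+ 2) (_ * (r k)%:R) => z t; lra.
  have dji : (d k i + 1 <= d k j)%N.
    rewrite -(ler_nat R) natrD -subr_ge0.
    have z0 : 0 < 8 * (n k)%:R ^+ 2 :> R by rewrite mulr_gt0 ?exprn_gt0.
    by rewrite -(pmulr_rge0 _ z0) opprD addrA (le_trans _ h2).
  have dE : (d k j - d k i - 1)%:R = (d k j)%:R - (d k i)%:R - 1 :> R.
    by rewrite -subnDA natrB// natrD opprD addrA.
  rewrite -(ler_nat R) (natrM _ (j - i)) (natrM _ (32 * N k)) dE (le_trans h2)//.
  rewrite ler_wpM2r//; first by rewrite -dE.
  by rewrite -natrX -!natrM ler_nat (@leq_trans (8 * (4 * N k))) ?leq_mul2l ?h1// mulnA.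
have w0 := cell_den0 S.
have [X XP] := cantor_map_exists R w r N d w0 wS N2 dr.
exists X; split.
  move=> u u01; have u0 : 0 <= u by case/andP: u01.
  have XPk k := XP u k u0.
  split; first by have := XPk 0%N; rewrite w0 /= invr1 !mulr1.
  move=> k; pose P := address r N d k (cell_index R N u k).
  pose i := (cell_index R N u k.+1 %% N k)%N.
  have iN : (i < N k)%N by rewrite ltn_pmod// ltnW.
  have [_ /(_ i iN)[b0 b1 cb] _] := fP k.
  have Pw : (P < w k)%N.
    by apply: (address_lt _ _ _ _ w0 wS N2 dr); apply: cell_index_lt.
  exists (b k i), (P * b k i + c k i)%N; split; first by rewrite b0.
    by rewrite (@leq_trans (P.+1 * b k i)%N) ?leq_mul2r ?Pw ?orbT// mulSn addnC leq_add2r ltnW.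
  have := XPk k.+1; rewrite /= cell_indexS// -/i -/P -natr1 natrD => /andP[lo hi].
  have := dlo k i iN; have := dhi k i iN.
  have wR : 0 < (w k)%:R :> R by rewrite ltr0n cell_den_gt0.
  have rR : 0 < (r k)%:R :> R by rewrite ltr0n.
  have bR : 0 < (b k i)%:R :> R by rewrite ltr0n.
  have w'R : 0 < (w k.+1)%:R :> R by rewrite ltr0n cell_den_gt0.
  have -> : (P * b k i + c k i)%:R / (w k * b k i)%:R =
    ((P * r k)%:R + (r k)%:R * ((c k i)%:R / (b k i)%:R)) / (w k.+1)%:R :> R.
    rewrite wS natrD (natrM _ P (b k i)) (natrM _ P (r k)) (natrM _ (w k) (r k)) (natrM _ (w k) (b k i)).
    by field; rewrite !gt_eqF.
  set z := (r k)%:R * _ => zhi zlo.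
  apply: (@le_trans _ _ (w k.+1)%:R^-1); last first.
    rewrite lef_pV2 ?posrE// ?exprn_gt0 ?ltr0n ?line_den_gt0// -natrX ler_nat wS /r.
    by rewrite mulnA leq_pmull// muln_gt0 cell_den_gt0.
  rewrite -[X in _ <= X]mul1r ler_pdivlMr// -[X in _ * X]gtr0_norm// -normrM mulrBl divfK ?gt_eqF//.
  rewrite ler_pdivrMr// in lo; rewrite ler_pdivlMr// in hi.
  rewrite ler_norml; apply/andP; split; lra.
move=> s /andP[s0 sa].
(* From level k0 on, s is at most the exponent in farey_order_large; the levels
   below k0 are handled by the constant w k0. *)
pose k0 := Num.truncn (alpha / (alpha - s)).
have wR k : 1 <= (w k)%:R :> R by rewrite ler1n cell_den_gt0.
have K0 : 0 < (w k0)%:R :> R by rewrite (lt_le_trans ltr01).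
have MR k : 1 <= (cells N k)%:R :> R by rewrite ler1n (leq_ltn_trans _ (cells_gt _ N2 k)).
have KP k : (w k)%:R `^ s <= (w k0)%:R * (cells N k)%:R :> R.
  have [kk0|] := leqP k k0.
    rewrite (@le_trans _ _ (w k)%:R)//; first by rewrite ler1_powR// (le_trans (ltW sa)).
    by rewrite (@le_trans _ _ (w k0)%:R) ?ler_nat ?cell_den_homo// ler_peMr// ltW.
  case: k => // k; rewrite ltnS => k0k.
  have sk : s <= alpha - alpha / k.+1%:R.
    rewrite lerBrDr -lerBrDl ler_pdivrMr// mulrC -ler_pdivrMr ?subr_gt0//.
    by rewrite (le_trans (ltW (truncnS_gt _)))// ler_nat ltnS.
  rewrite (le_trans (ler_powR (wR _) sk))//.
  rewrite (@le_trans _ _ (cells N k.+1)%:R)//; last by rewrite ler_peMl// (le_trans ler01).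
  rewrite (@le_trans _ _ (N k)%:R)//; last first.
    by rewrite ler_nat cellsS leq_pmull// (leq_ltn_trans _ (cells_gt _ N2 k)).
  rewrite -(ler_pM2l (_ : 0 < 4))// (le_trans (farey_order_large S k))//.
  by have [h1 _ _] := fP k; rewrite -natrX -natrM ler_nat.
exists (64 * (w k0)%:R); first by rewrite mulr_gt0.
move=> u v u0 uv v1; apply: (cantor_map_holder _ _ _ _ _ w0 wS N2 dr gap) => //.
by rewrite s0 (le_trans (ltW sa)).
Qed.
End ScaleSystem.

Arguments line_den_gt0 {R alpha h} S.
Arguments cell_den_gt0 {R alpha h} S.
Arguments line_parameters {R alpha h} S.
Arguments rational_cantor_set {R alpha h} S.


(** * The projective chart *)

(** The boolean tells whether the two coordinates are kept in order or exchanged. *)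
Definition plane_point (R : realType) (sigma : bool) (x y : R) : 'rV[R]_2 :=
  \row_(i < 2) if (i == ord0) == sigma then x else y.

Lemma plane_point_dist (R : realType) (sigma : bool) (x y x' y' : R) :
  euclidean_norm (plane_point R sigma x y - plane_point R sigma x' y')
  = Num.sqrt ((x - x') ^+ 2 + (y - y') ^+ 2).
Proof.
rewrite /euclidean_norm !big_ord_recl big_ord0 !mxE addr0 /=.
by case: sigma => //=; congr (Num.sqrt _); exact: addrC.
Qed.

Lemma plane_point_dist_ge (R : realType) (sigma : bool) (x y x' y' : R) :
  `|x - x'| <= euclidean_norm (plane_point R sigma x y - plane_point R sigma x' y').
Proof.
rewrite plane_point_dist -sqrtr_sqr ler_sqrt ?addr_ge0 ?sqr_ge0//.
by rewrite lerDl sqr_ge0.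
Qed.

Lemma plane_point_dist_le (R : realType) (sigma : bool) (x y x' y' : R) :
  euclidean_norm (plane_point R sigma x y - plane_point R sigma x' y')
  <= `|x - x'| + `|y - y'|.
Proof.
rewrite plane_point_dist -[leRHS]ger0_norm ?addr_ge0// -sqrtr_sqr ler_sqrt ?sqr_ge0//.
rewrite -(real_normK (num_real (x - x'))) -(real_normK (num_real (y - y'))).
have := normr_ge0 (x - x'); have := normr_ge0 (y - y'); nra.
Qed.

Definition pencil_point (R : realType) (sigma : bool) (X Y : R) : 'rV[R]_2 :=
  plane_point R sigma (X + Num.sqrt 2)^-1 (Y / (X + Num.sqrt 2)).

Lemma sqrt2_itv (R : realType) : 1 <= Num.sqrt (2 : R) <= 3 / 2.
Proof.
have := sqr_sqrtr (ler0n R 2); have := sqrtr_ge0 (2 : R).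
by move: (Num.sqrt 2) => t t0 tt; apply/andP; split; nra.
Qed.

(** The map X -> 1/(X + sqrt 2) contracts by a factor of at most
(1 + sqrt 2)^2 < 9 on [0, 1], and the distance dominates the first coordinate. *)
Lemma pencil_point_expand (R : realType) (sigma : bool) (X Y X' Y' : R) :
  0 <= X <= 1 -> 0 <= X' <= 1 ->
  `|X - X'| <= 9 * euclidean_norm (pencil_point R sigma X Y - pencil_point R sigma X' Y').
Proof.
move=> /andP[X0 X1] /andP[X'0 X'1].
have /andP[t1 t2] := sqrt2_itv R.
apply: le_trans (ler_wpM2l (ler0n _ 9) (plane_point_dist_ge _ _ _ _ _ _)).
move: (Num.sqrt 2) t1 t2 => t t1 t2.
have Xt : 0 < X + t by lra.
have X't : 0 < X' + t by lra.
have -> : X - X' = (X' + t) * (X + t) * ((X' + t)^-1 - (X + t)^-1).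
  by field; rewrite !gt_eqF.
rewrite normrM distrC ler_wpM2r// ger0_norm; first nra.
by rewrite mulr_ge0// ltW.
Qed.

Lemma pencil_point_lipschitz (R : realType) (sigma : bool) (X Y X' Y' : R) :
  0 <= X -> 0 <= X' -> `|Y'| <= 10 ->
  euclidean_norm (pencil_point R sigma X Y - pencil_point R sigma X' Y')
  <= `|Y - Y'| + 11 * `|X - X'|.
Proof.
move=> X0 X'0 Y'10.
have /andP[t1 t2] := sqrt2_itv R.
apply: le_trans (plane_point_dist_le _ _ _ _ _ _) _.
move: (Num.sqrt 2) t1 t2 => t t1 t2.
have Xt : 1 <= X + t by lra.
have X't : 1 <= X' + t by lra.
have inv (z : R) : 1 <= z -> 0 <= z^-1 <= 1.
  by move=> z1; rewrite invr_ge0 invf_le1 ?z1 ?(le_trans ler01 z1)// (lt_le_trans ltr01).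
have dx : `|(X + t)^-1 - (X' + t)^-1| <= `|X - X'|.
  have -> : (X + t)^-1 - (X' + t)^-1 = (X' - X) * ((X + t)^-1 * (X' + t)^-1).
    by field; rewrite !gt_eqF// (lt_le_trans ltr01).
  have /andP[a0 a1] := inv _ Xt; have /andP[b0 b1] := inv _ X't.
  by rewrite normrM distrC ler_piMr// ger0_norm ?mulr_ge0// mulr_ile1.
have dy : `|Y / (X + t) - Y' / (X' + t)| <= `|Y - Y'| + 10 * `|X - X'|.
  have -> : Y / (X + t) - Y' / (X' + t) = (Y - Y') / (X + t) + Y' * ((X + t)^-1 - (X' + t)^-1) by ring.
  rewrite (le_trans (ler_normD _ _))// lerD// normrM.
    by have /andP[a0 a1] := inv _ Xt; rewrite ler_piMr// ger0_norm.
  by apply: ler_pM.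
rewrite (le_trans (lerD dx dy))//; lra.
Qed.

(** * The Furstenberg set *)

Section FurstenbergSet.
Variables (R : realType) (alpha : R) (h : R -> R) (S : scale_system R alpha h).

Local Notation m := (line_den S).
Local Notation w := (cell_den S).
Local Notation n := (fun k => farey_order R alpha (m k.+1)).

Definition rational_abscissa (X : R) : Prop := forall k, exists b p : nat,
  [/\ (0 < b <= 2 * n k)%N, (p <= w k * b)%N &
      `|X - p%:R / (w k * b)%:R| <= ((m k.+1)%:R ^+ 2)^-1].

Definition rational_line (A B : R) : Prop := forall k, exists j i : nat,
  `|A - j%:R / (m k.+1)%:R| <= ((m k.+1)%:R ^+ 2)^-1 /\
  `|B - i%:R / (m k.+1)%:R| <= (8 * m k ^ 2)%:R / (m k.+1)%:R ^+ 2.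

Definition furstenberg_set : set 'rV[R]_2 := [set v | exists sigma X A B,
  v = pencil_point R sigma X (A * X + B) /\
  [/\ 0 <= X <= 1, 1 <= A <= 2, 0 <= B <= 4, rational_abscissa X & rational_line A B]].

(** Write e = (f, g) with |g| <= |f|, exchanging the coordinates if necessary.  The
line of slope a = g/f given by [line_parameters] meets the second axis at (0, A).
Its points of the set have first coordinate x in [0, 1], and
(x, A + a x) = (0, A) + (x/f) e with |x/f| <= 2, so they lie on the segment of
length 4 starting at (0, A) - 2 e, whatever the sign of f. *)
Lemma furstenberg_set_dim : 0 < alpha <= 1 -> furstenberg alpha furstenberg_set.
Proof.
move=> a01 e e1; have /andP[t1 t2] := sqrt2_itv R.
have [sigma [f [g [ee fg gf]]]] : exists sigma f g, [/\ e = plane_point R sigma f g,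
    f ^+ 2 + g ^+ 2 = 1 & `|g| <= `|f|].
  have e2 : e ord0 ord0 ^+ 2 + e ord0 ord_max ^+ 2 = 1.
    rewrite -[LHS]sqr_sqrtr ?addr_ge0 ?sqr_ge0//; move: e1.
    rewrite /euclidean_norm !big_ord_recl big_ord0 addr0.
    by rewrite (_ : lift ord0 ord0 = ord_max) => [->|]; [rewrite expr1n|apply: val_inj].
  have ord2 (i : 'I_2) : i = if i == ord0 then ord0 else ord_max.
    by apply: val_inj; case: i => -[|[|//]].
  have [ge|/ltW ge] := leP `|e ord0 ord_max| `|e ord0 ord0|.
    exists true, (e ord0 ord0), (e ord0 ord_max); split => //.
    apply/rowP => i; rewrite !mxE [in LHS](ord2 i); by case: (i == ord0).
  exists false, (e ord0 ord_max), (e ord0 ord0); split => //; last by rewrite addrC.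
  apply/rowP => i; rewrite !mxE [in LHS](ord2 i); by case: (i == ord0).
have f2 : 1 <= 2 * `|f|.
  have := normr_ge0 g; have := normr_ge0 f; move: fg gf.
  rewrite -(real_normK (num_real f)) -(real_normK (num_real g)); nra.
have f0 : f != 0 by rewrite -normr_gt0; lra.
pose a := g / f.
have a1 : -1 <= a <= 1.
  by rewrite -ler_norml normrM normfV ler_pdivrMr ?normr_gt0// mul1r.
have [A [A12 AP]] := line_parameters S _ a1.
pose B := a + A * Num.sqrt 2.
have B04 : 0 <= B <= 4.
  move: A12 a1 t1 t2; rewrite /B; move: (Num.sqrt 2) => t /andP[? ?] /andP[? ?] ? ?.
  by apply/andP; split; nra.
have [X [XP XH]] := rational_cantor_set S a01.
exists (plane_point R sigma 0 A - 2 *: e), 4; split => //.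
have inE u : 0 <= u < 1 -> (furstenberg_set `&` segment (plane_point R sigma 0 A - 2 *: e) e 4)
    (pencil_point R sigma (X u) (A * X u + B)).
  move=> u01; have [Xu01 XuP] := XP u u01; split.
    by exists sigma, (X u), A, B; split => //; split.
  case/andP: Xu01 => Xu0 Xu1.
  pose x := (X u + Num.sqrt 2)^-1.
  have xt : 1 <= X u + Num.sqrt 2 by lra.
  have x0 : 0 <= x by rewrite invr_ge0; lra.
  have x1 : x <= 1 by rewrite invf_le1//; lra.
  have xf : `|x / f| <= 2.
    by rewrite normrM (normfV f) ler_pdivrMr ?normr_gt0// ger0_norm//; lra.
  exists (2 + x / f).
    by rewrite /= in_itv/=; move: xf; rewrite ler_norml => /andP[? ?]; apply/andP; split; lra.
  rewrite /pencil_point -/x (_ : (A * X u + B) * x = A + x / f * g); last first.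
    by rewrite /B /a /x; field; rewrite f0 gt_eqF//; lra.
  by apply/rowP => i; rewrite ee !mxE; case: (_ == sigma); field.
apply/ereal_infP => _ [s [s0 Hs] <-]; rewrite lee_fin leNgt; apply/negP => sa.
have [|K K0 XK] := XH s; first by rewrite sa (ltW s0).
have s1 : s <= 1 by case/andP: a01 => _; apply: le_trans; exact: ltW.
apply: (hausdorff_measure_powR_neq0 _ _ s (9 * K) _ _ (ltW s0) _ inE _ Hs).
  by rewrite mulr_gt0.
move=> u v u0 uv v1; rewrite (le_trans (XK _ _ u0 uv v1))// mulrAC [leRHS]mulrC ler_pM2l//.
have [|Xu _] := XP u; first by rewrite u0 (lt_trans uv).
have [|Xv _] := XP v; first by rewrite v1 (le_trans u0)// ltW.
have := pencil_point_expand _ sigma _ (A * X v + B) _ (A * X u + B) Xv Xu.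
set E := euclidean_norm _ => XE.
have E0 : 0 <= E by exact: sqrtr_ge0.
rewrite (@le_trans _ _ ((9 * E) `^ s))//.
  by apply: ge0_ler_powR => //; rewrite ?nnegrE ?mulr_ge0// ltW.
by rewrite powRM// ler_wpM2r ?powR_ge0// ler1_powR// ler1n.
Qed.
(** The value at p/q of the line with coefficients j/m and i/m is
(j p + i q)/(m q). *)
Lemma rational_ordinate (k : nat) (X A B : R) :
  0 <= X <= 1 -> 1 <= A <= 2 -> 0 <= B <= 4 -> rational_abscissa X -> rational_line A B ->
  exists b p r : nat, [/\ (b <= 2 * n k)%N, (p <= 2 * w k * n k)%N, (r <= 20 * m k.+1 * w k * n k)%N,
    `|X - p%:R / (w k * b)%:R| <= ((m k.+1)%:R ^+ 2)^-1 &
    `|A * X + B - r%:R / (m k.+1 * w k * b)%:R| <= (12 * m k ^ 2)%:R / (m k.+1)%:R ^+ 2].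
Proof.
have arith (x y z : nat) : (3 * x * (2 * y * z) + 6 * x * (2 * y * z) <= 20 * x * y * z)%N by lia.
move=> /andP[X0 X1] /andP[A1 A2] /andP[B0 B4] /(_ k)[b [p [/andP[b0 bn] pw Xp]]] /(_ k)[j [i [Aj Bi]]].
have m0k := line_den_gt0 S k; have m0 := line_den_gt0 S k.+1; have w0 := cell_den_gt0 S k.
have m2 : (2 * m k ^ 2 <= m k.+1)%N by rewrite line_denS leq_pmulr// pell_den_gt0.
have mR : 1 <= (m k.+1)%:R :> R by rewrite ler1n line_den_gt0.
have mR0 : 0 < (m k.+1)%:R :> R by rewrite ltr0n line_den_gt0.
set M := (m k.+1)%:R in Xp Aj Bi mR mR0 *.
have e1 : (M ^+ 2)^-1 <= 1 by rewrite invf_le1 ?exprn_gt0// exprn_ege1.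
have e2 : (8 * m k ^ 2)%:R / M ^+ 2 <= 2.
  rewrite ler_pdivrMr ?exprn_gt0// -natrX -natrM ler_nat.
  rewrite (@leq_trans (2 * (2 * m k ^ 2) ^ 2))// ?leq_mul2l ?leq_exp2r//.
  by rewrite expnMn mulnA leq_mul2l/= [leqRHS]expnS expn1 leq_pmulr// expn_gt0 m0k.
have j3 : j%:R / M <= 3 by move: Aj; rewrite ler_norml => /andP[? ?]; lra.
have i6 : i%:R / M <= 6 by move: Bi; rewrite ler_norml => /andP[? ?]; lra.
have jm : (j <= 3 * m k.+1)%N by move: j3; rewrite ler_pdivrMr// -natrM ler_nat.
have im : (i <= 6 * m k.+1)%N by move: i6; rewrite ler_pdivrMr// -natrM ler_nat.
have qn : (w k * b <= 2 * w k * n k)%N by rewrite (mulnC 2) -mulnA leq_mul2l bn orbT.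
exists b, p, (j * p + i * (w k * b))%N; split => //; first exact: leq_trans qn.
  rewrite (@leq_trans (3 * m k.+1 * (2 * w k * n k) + 6 * m k.+1 * (2 * w k * n k))%N)//.
    by rewrite leq_add// leq_mul// (leq_trans pw).
have qR : 0 < (w k * b)%:R :> R by rewrite ltr0n muln_gt0 w0.
have -> : A * X + B - (j * p + i * (w k * b))%:R / (m k.+1 * w k * b)%:R =
    (A - j%:R / M) * X + j%:R / M * (X - p%:R / (w k * b)%:R) + (B - i%:R / M).
  by rewrite -mulnA natrD (natrM _ j) (natrM _ i) (natrM _ (m k.+1)) -/M; field; rewrite !pnatr_eq0 -!lt0n m0 b0 w0.
have h1 : `|(A - j%:R / M) * X| <= (M ^+ 2)^-1.
  by rewrite normrM (ger0_norm X0) (le_trans _ Aj)// ler_piMr.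
have h2 : `|j%:R / M * (X - p%:R / (w k * b)%:R)| <= 3 * (M ^+ 2)^-1.
  by rewrite normrM ger0_norm ?divr_ge0//; apply: ler_pM => //; rewrite divr_ge0.
rewrite (le_trans (ler_normD _ _))// (le_trans (lerD (ler_normD _ _) (lexx _)))//.
rewrite (le_trans (lerD (lerD h1 h2) Bi))//.
have -> : (M ^+ 2)^-1 + 3 * (M ^+ 2)^-1 + (8 * m k ^ 2)%:R / M ^+ 2 = (4 + (8 * m k ^ 2)%:R) / M ^+ 2 by ring.
rewrite ler_wpM2r ?invr_ge0 ?exprn_ge0// -natrD ler_nat.
by rewrite (_ : 12 = 4 + 8)%N// mulnDl leq_add2r leq_pmulr// expn_gt0 m0k.
Qed.
(** At scale k+1 the cover is indexed by the order of the coordinates, by b and p for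
the fraction p/(w b) near X, and by the numerator r of the ordinate.  There are at
most 2 (3n) (3wn) (21mwn) = 378 w^2 m n^3 indices, and n^3 <= m^(3 alpha). *)
Lemma furstenberg_set_null : dimension_function h -> hausdorff_measure h furstenberg_set = 0%E.
Proof.
move=> hh; apply: hausdorff_measure_eq0 => // eps eps0.
pose k := Num.truncn eps^-1.
have keps : k.+1%:R^-1 <= eps.
  by rewrite -[leRHS]invrK lef_pV2 ?posrE ?invr_gt0// ltW// truncnS_gt.
have m0k := line_den_gt0 S k; have m0 := line_den_gt0 S k.+1.
have w0 := cell_den_gt0 S k.
have mR : 0 < (m k.+1)%:R :> R by rewrite ltr0n.
pose T : finType := (bool * ('I_(2 * n k).+1 * ('I_(2 * w k * n k).+1 * 'I_(20 * m k.+1 * w k * n k).+1)))%type.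
pose F (t : T) : set 'rV[R]_2 := let: (sigma, (b, (p, r))) := t in
  [set v | exists X Y, [/\ v = pencil_point R sigma X Y, 0 <= X, `|Y| <= 10,
    `|X - (val p)%:R / (w k * val b)%:R| <= ((m k.+1)%:R ^+ 2)^-1 &
    `|Y - (val r)%:R / (m k.+1 * w k * val b)%:R| <= (12 * m k ^ 2)%:R / (m k.+1)%:R ^+ 2]].
exists T, F, ((68 * m k ^ 2)%:R / (m k.+1)%:R ^+ 2); split.
- rewrite divr_ge0 ?exprn_ge0//=; exact: lt_le_trans (cover_mesh S k) keps.
- move=> [sigma [b [p r]]]; apply: diam_le; first by rewrite divr_ge0 ?exprn_ge0.
  move=> _ _ [X [Y [-> X0 Y10 Xp Yr]]] [X' [Y' [-> X'0 Y'10 X'p Y'r]]].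
  rewrite (le_trans (pencil_point_lipschitz _ _ _ _ _ _ X0 X'0 Y'10))//.
  have near2 (x y z r' : R) : `|x - z| <= r' -> `|y - z| <= r' -> `|x - y| <= 2 * r'.
    move=> xz yz; rewrite (_ : x - y = (x - z) - (y - z)) ?(le_trans (ler_normB _ _))//; last by ring.
    by rewrite (le_trans (lerD xz yz))// mulrDl mul1r.
  have := near2 _ _ _ _ Xp X'p; have := near2 _ _ _ _ Yr Y'r.
  have z1 : 1 <= (m k ^ 2)%:R :> R by rewrite ler1n expn_gt0 m0k.
  have e0 : 0 <= ((m k.+1)%:R ^+ 2)^-1 :> R by rewrite invr_ge0 exprn_ge0.
  have := ler_wpM2r e0 z1; rewrite !(natrM _ _ (m k ^ 2)) mul1r -!mulrA.
  move: ((m k.+1)%:R ^+ 2)^-1 e0 => e e0; move: ((m k ^ 2)%:R * e) => z; lra.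
- move=> v [sigma [X [A [B [-> [X01 A12 B04 XP ABP]]]]]].
  have [b [p [r [bn pn rn Xp Yr]]]] := rational_ordinate k X A B X01 A12 B04 XP ABP.
  exists (sigma, (Ordinal (bn : b < _.+1)%N, (Ordinal (pn : p < _.+1)%N, Ordinal (rn : r < _.+1)%N))).
  exists X, (A * X + B); split => //; first by case/andP: X01.
  case/andP: X01 A12 B04 => X0 X1 /andP[A1 A2] /andP[B0 B4].
  rewrite ger0_norm; nra.
have arith (x y z : nat) : (0 < x)%N -> (0 < y)%N -> (0 < z)%N ->
   (2 * ((2 * z).+1 * ((2 * y * z).+1 * (20 * x * y * z).+1)) <= 378 * y ^ 2 * x * z ^ 3)%N.
  move=> x0 y0 z0.
  have yz : (0 < y * z)%N by rewrite muln_gt0 y0.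
  have xyz : (0 < x * y * z)%N by rewrite !muln_gt0 x0 y0.
  rewrite (@leq_trans (2 * ((3 * z) * ((3 * y * z) * (21 * x * y * z)))))//; last first.
    by rewrite leq_eqVlt; apply/orP; left; apply/eqP; ring.
  by rewrite leq_mul2l/= leq_mul//; [lia|rewrite leq_mul//; lia].
have n0 : (0 < n k)%N by rewrite (leq_trans _ (farey_order_gt2 S k)).
have cardT : (#|{: T}| <= 378 * w k ^ 2 * m k.+1 * n k ^ 3)%N.
  by rewrite !card_prod card_bool !card_ord arith.
have n3 : (n k ^ 3)%:R <= (m k.+1)%:R `^ (3 * alpha) :> R.
  rewrite mulrC powRrM powR_mulrn ?powR_ge0// natrX lerXn2r ?nnegrE ?powR_ge0//.
  by rewrite truncn_le powR_ge0.
rewrite (le_trans _ keps)// (le_trans _ (cover_cost S k))//.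
apply: ler_wpM2r.
  by case: hh => h0 _ _ _; apply: h0; rewrite divr_ge0 ?exprn_ge0.
rewrite (@le_trans _ _ (378 * w k ^ 2 * m k.+1 * n k ^ 3)%:R) ?ler_nat//.
by rewrite natrM; apply: ler_wpM2l; [exact: ler0n|exact: n3].
Qed.
End FurstenbergSet.

Arguments furstenberg_set {R alpha h} S.


Theorem theorem2p4 (R : realType) (alpha theta : R) (h : R -> R) :
  0 < alpha -> alpha <= 1 -> 0 < theta ->
  is_htheta alpha theta h ->
  (1 + 3 * alpha) / 2 < theta ->
  exists E : set 'rV[R]_2,
    furstenberg alpha E /\ hausdorff_measure h E = 0%E.
Proof.
move=> a0 a1 th0 hh _; have a01 : 0 < alpha <= 1 by rewrite a0.
have [S] := scale_system_exists _ _ _ _ a01 th0 hh.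
exists (furstenberg_set S); split; first exact: furstenberg_set_dim.
by apply: furstenberg_set_null; case: hh.
Qed.
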